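(* Let $k\in\mathbb{N}\cup\{0\}$, $\varepsilon_0,\dots,\varepsilon_k\in\mathbb{R}_+$, and set \[ \varepsilon=\min\Big\{\tfrac{(k+2)\varepsilon_i}{k+1-i}\ \Big|\ i\in\{0,\dots,k\}\Big\},\qquad \lambda=\tfrac1d\min\Big\{\big(\tfrac{\varepsilon}{(k+1)^2 2^{2k+6}}\big)^{2^k},1\Big\}. \] Let $(X,\mathcal{F})$ be a sheaved strongly connected $d$-complex with $d\ge k+1$ such that: (1) $(X,\mathcal{F})$ is an $i$-local $\varepsilon_i$-coboundary expander in dimension $k$ for all $i\in\{0,\dots,k\}$; (2) $X$ is a $(d-2)$-local $[-1,\lambda]$-spectral expander; (3) $\mathcal{F}(x)\ne0$ for all $x\in X(k+1)$. Then $(X,\mathcal{F})$ $\frac{\varepsilon}{2}$-expands $\big(\frac{\varepsilon}{(k+1)^22^{2k+6}}\big)^{2^{k+1}-1}$-small locally minimal $k$-cochains.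
   Context: A $d$-complex is a finite simplicial complex (faces are finite vertex sets closed under subsets, including $\emptyset$) in which every face lies in a $d$-face; $X(i)$ denotes the $i$-faces. Link $X_z=\{x\setminus z:z\subseteq x\in X\}$; $X$ is strongly connected if all links $X_z$ ($z\in X$, including $z=\emptyset$) are connected. Canonical weight of $x\in X(k)$: $w(x)=\binom{d+1}{k+1}^{-1}|X(d)|^{-1}|\{y\in X(d):y\supseteq x\}|$. A sheaf $\mathcal{F}$ on $X$: abelian groups $\mathcal{F}(x)$ for nonempty $x$ and homomorphisms $\mathrm{res}_{y\leftarrow x}$ for nonempty $x\subsetneq y$ compatible under composition; augmented sheaves also include $\emptyset$ (sheaves have $\mathcal{F}(\emptyset)=0$). $C^k(X,\mathcal{F})$: alternating families over ordered $k$-faces; $(d_kf)(v_0..v_{k+1})=\sum_i(-1)^i\mathrm{res}f(v_0..\widehat{v_i}..v_{k+1})$; $B^k=\mathrm{im}\,d_{k-1}$. $\mathcal{F}_z$ on $X_z$: $\mathcal{F}_z(x)=\mathcal{F}(x\cup z)$ with induced restrictions. Norm $\|f\|=w(\{x:f(x)\neq0\})$ with respect to the canonical weights of the complex at hand; mass $m(k)=w(\{x\in X(k):\mathcal{F}(x)\ne0\})$. $\varepsilon$-coboundary expander in dimension $k$: $\|d_kf\|m(k)\ge\varepsilon\min_{b\in B^k}\|f+b\|m(k+1)$ for all $f\in C^k$. $i$-local $\varepsilon$-coboundary expander in dimension $k$: $(X_z,\mathcal{F}_z)$ is an $\varepsilon$-coboundary expander in dimension $k-i-1$ for all $z\in X(i)$.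 For an ordered face $z$ and $g\in C^j(X_z,\mathcal{F}_z)$, $g^z$ is the cochain on $X$ with $g^z(xz)=g(x)$ and $g^z(y)=0$ if $z\not\subseteq y$. $f\in C^k(X,\mathcal{F})$ is locally minimal if $\|f+d_{k-1}(g^z)\|\ge\|f\|$ for all $z\in X$ of dimension $i\in\{0,\dots,k-1\}$ and $g\in C^{k-i-2}(X_z,\mathcal{F}_z)$. ''$\beta$-expands $\alpha$-small locally minimal $k$-cochains'': $\|d_kf\|\ge\beta\|f\|$ for every locally minimal $f\in C^k$ with $\|f\|<\alpha$. Weighted adjacency operator $(\mathcal{A}f)(x)=\sum_{e\supseteq x}\frac{w(e)}{2w(x)}f(e\setminus x)$ on $\mathbb{R}^{X(0)}$; $[-1,\lambda]$-spectral expander: spectrum of $\mathcal{A}$ on mean-zero functions in $[-1,\lambda]$; $(d-2)$-local version: this holds for every link $X_z$, $z\in X(d-2)$, with its own canonical weights. *)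

(* Defs.v *)
From HB Require Import structures.
From mathcomp Require Export all_boot all_order all_fingroup all_algebra.
From mathcomp Require Export boolp reals.

Set Implicit Arguments.
Unset Strict Implicit.
Unset Printing Implicit Defensive.

Import Order.TTheory GRing.Theory Num.Theory.
Local Open Scope ring_scope.

(* Conventions.
   - A complex is its set of faces X : {set {set V}} over a finite type V; a
     member of V is a vertex of X only if its singleton is in X.
   - Faces, cochains, norms and masses are graded by the NUMBER OF VERTICES n,
     so grade n is dimension n - 1; grade 0 is the empty face, of dimension -1.
   - d is always the dimension of the complex at hand; the link of a face z in
     a d-complex has dimension d - #|z|. *)

Section Complexes.
Variable V : finType.
Implicit Types (X : {set {set V}}) (x y z : {set V}).

Definition is_dcomplex (d : nat) X : Prop :=
  [/\ set0 \in X,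
      (forall x y, y \in X -> x \subset y -> x \in X) &
      (forall x, x \in X -> exists2 y, y \in X & (#|y| == d.+1) && (x \subset y))].

Definition faces X (n : nat) : {set {set V}} := [set x in X | #|x| == n].

Definition link X z : {set {set V}} :=
  [set y :\: z | y in [set y in X | z \subset y]].

Definition adj X : rel V := [rel u v | [set u; v] \in X].

Definition connected_complex X : Prop :=
  forall u v, [set u] \in X -> [set v] \in X -> connect (adj X) u v.

(* Connectedness is only asked of the links of dimension >= 1, as usual for
   strong connectedness: the link of a (d-1)-face is a discrete set of points
   and the link of a d-face has no vertex. *)
Definition strongly_connected (d : nat) X : Prop :=
  forall z, z \in X -> (#|z| < d)%N -> connected_complex (link X z).

Definition ordered_face X (n : nat) x (v : seq V) : bool :=
  [&& x \in X, size v == n, uniq v & [set u in v] == x].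

End Complexes.

Section Weights.
Variables (R : realType) (V : finType).
Implicit Types (X : {set {set V}}) (x : {set V}).

Definition weight (d : nat) X x : R :=
  'C(d.+1, #|x|)%:R^-1 * #|faces X d.+1|%:R^-1
    * #|[set y in faces X d.+1 | x \subset y]|%:R.

(* Elements of R^X(0) are functions on {set V} of which only the values at the
   singleton faces matter. *)
Definition adjacency (d : nat) X (f : {set V} -> R) x : R :=
  \sum_(e in faces X 2 | x \subset e)
     weight d X e / (2 * weight d X x) * f (e :\: x).

Definition mean_zero (d : nat) X (f : {set V} -> R) : Prop :=
  \sum_(x in faces X 1) weight d X x * f x = 0.

(* The adjacency operator is self-adjoint for the weighted inner product, so
   its spectrum on the mean-zero functions is its set of real eigenvalues. *)
Definition spectral_expander (d : nat) X (lo hi : R) : Prop :=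
  forall (mu : R) (f : {set V} -> R),
    mean_zero d X f ->
    (exists2 x, x \in faces X 1 & f x != 0) ->
    (forall x, x \in faces X 1 -> adjacency d X f x = mu * f x) ->
    lo <= mu <= hi.

(* z ranges over the faces of dimension i - 1. *)
Definition local_spectral_expander (d : nat) X (i : nat) (lo hi : R) : Prop :=
  forall z, z \in faces X i -> spectral_expander (d - #|z|) (link X z) lo hi.

End Weights.

(* Values of sec outside X, and of res outside pairs of faces x \proper y, are
   irrelevant: nothing below depends on them. *)
Record aug_sheaf (V : finType) (X : {set {set V}}) := AugSheaf {
  sec :> {set V} -> zmodType;
  res : forall x y : {set V}, {additive sec x -> sec y};
  res_comp : forall x y z : {set V},
    x \in X -> y \in X -> z \in X -> x \proper y -> y \proper z ->
    forall a : sec x, res y z (res x y a) = res x z a }.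

Section Sheaves.
Variables (V : finType) (X : {set {set V}}).
Implicit Types (F : aug_sheaf X) (x y z : {set V}) (n d : nat).

Definition nontrivial (A : zmodType) : Prop := exists a : A, a != 0.

Definition is_sheaf F : Prop := forall a : F set0, a = 0.

Lemma link_setU z x : x \in link X z -> x :|: z \in X.
Proof.
case/imsetP=> y; rewrite inE => /andP[yX zy] ->.
by rewrite setDE setUIl [~: z :|: z]setUC setUCr setIT (setUidPl zy).
Qed.

Lemma link_proper z x y : x \in link X z -> y \in link X z ->
  x \proper y -> x :|: z \proper y :|: z.
Proof.
case/imsetP=> x' _ ->; case/imsetP=> y' _ ->.
rewrite !properE => /andP[sxy nyx]; rewrite setSU //=.
apply: contra nyx => /subsetP s; apply/subsetP=> u uy.
have := s u; rewrite !inE in uy *.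
by case/andP: uy => /negbTE -> ->; rewrite !orbF => ->.
Qed.

Lemma link_res_comp F z (x y t : {set V}) :
  x \in link X z -> y \in link X z -> t \in link X z ->
  x \proper y -> y \proper t ->
  forall a : F (x :|: z),
    res F (y :|: z) (t :|: z) (res F (x :|: z) (y :|: z) a)
      = res F (x :|: z) (t :|: z) a.
Proof.
move=> xX yX tX xy yt a.
by apply: res_comp; rewrite ?link_setU ?(link_proper (z := z)).
Qed.

Definition link_sheaf F z : aug_sheaf (link X z) :=
  @AugSheaf V (link X z) (fun x => F (x :|: z))
    (fun x y => res F (x :|: z) (y :|: z)) (@link_res_comp F z).

(* An ordered face is given redundantly as a pair (x, v) where the sequence v
   enumerates x; f x v is the value of f at v, an element of F x. Only the values
   at ordered faces of X matter. This spares transporting values of f along the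
   equality of the vertex sets of two orderings of the same face. *)
Definition cochain F := forall x : {set V}, seq V -> F x.

Definition is_cochain F n (f : cochain F) : Prop :=
  forall (x : {set V}) (v : n.-tuple V) (s : 'S_n), ordered_face X n x v ->
    f x [tuple tnth v (s i) | i < n] = f x v *~ (-1) ^+ s.

Definition addc F (f g : cochain F) : cochain F := fun x v => f x v + g x v.

Definition del (v : seq V) (i : nat) : seq V := take i v ++ drop i.+1 v.

Definition cobd F (f : cochain F) : cochain F := fun y v =>
  \sum_(i < size v)
     res F (y :\ tnth (in_tuple v) i) y (f (y :\ tnth (in_tuple v) i) (del v i))
       *~ (-1) ^+ i.

(* There is no cochain below dimension -1, so B^(-1) = 0. *)
Definition is_coboundary F n (b : cochain F) : Prop :=
  if n is n'.+1 then
    exists2 g : cochain F, is_cochain n' g &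
      forall x v, ordered_face X n x v -> b x v = cobd g x v
  else forall x v, ordered_face X 0 x v -> b x v = 0.

Variable R : realType.

(* Whether f vanishes at x does not depend on the ordering of x. *)
Definition norm F d n (f : cochain F) : R :=
  \sum_(x in faces X n | f x (enum x) != 0) weight R d X x.

Definition mass F d n : R :=
  \sum_(x in faces X n | `[< nontrivial (F x) >]) weight R d X x.

(* b attains the minimum of ||f + b|| over the coboundaries. *)
Definition cobd_expander F d n (eps : R) : Prop :=
  forall f : cochain F, is_cochain n f ->
    exists b : cochain F,
      [/\ is_coboundary n b,
          (forall b' : cochain F, is_coboundary n b' ->
             norm d n (addc f b) <= norm d n (addc f b')) &
          eps * norm d n (addc f b) * mass F d n.+1
            <= norm d n.+1 (cobd f) * mass F d n].

End Sheaves.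

Section LocalExpansion.
Variables (R : realType) (V : finType) (X : {set {set V}}).
Implicit Types (F : aug_sheaf X) (z : {set V}) (n d : nat).

(* h is g^z, where v is the ordered face z and h has grade n. *)
Definition is_extension F n z (v : seq V)
    (g : cochain (link_sheaf F z)) (h : cochain F) : Prop :=
  [/\ is_cochain n h,
      (forall x t, ordered_face (link X z) (n - size v) x t ->
         h (x :|: z) (t ++ v) = g x t) &
      (forall y t, ordered_face X n y t -> ~~ (z \subset y) -> h y t = 0)].

Definition locally_minimal F d n (f : cochain F) : Prop :=
  forall m z v, (0 < m < n)%N -> ordered_face X m z v ->
  forall g : cochain (link_sheaf F z), is_cochain (n.-1 - m) g ->
  forall h : cochain F, is_extension n.-1 v g h ->
    norm R d n f <= norm R d n (addc f (cobd h)).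

Definition expands_small_locally_minimal F d n (beta alpha : R) : Prop :=
  forall f : cochain F, is_cochain n f -> locally_minimal d n f ->
    norm R d n f < alpha -> beta * norm R d n f <= norm R d n.+1 (cobd f).

(* z ranges over the faces of dimension i - 1, and (X_z, F_z) is required to
   expand in grade n - i, i.e. in dimension (n - 1) - (i - 1) - 1. *)
Definition local_cobd_expander F d (i n : nat) (eps : R) : Prop :=
  forall z, z \in faces X i ->
    cobd_expander (link_sheaf F z) (d - #|z|) (n - i) eps.

End LocalExpansion.

(* Main.v *)
(* Let [A] be the support of a locally minimal cochain [f], and call a face [z]
   fat when, recursively downwards from [A], the fat faces covering [z] make up
   at least a fraction [h_j] of its neighbourhood, where [j = #|z|] and
   [h_j = eta ^ (2 ^ (k - j))]. As [f] is small, the empty face is not fat, so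
   descending from [x \in A] through fat faces ends at a nonempty minimal fat
   face [z]. The part of [f] that descends to [z] is still minimal in the link of
   [z], so local coboundary expansion makes its coboundary large. If a (k+1)-face
   [y] is good, i.e. any two fat faces of [y] that meet in codimension one meet in
   a fat face, then all members of [A] inside [y] descend to the same [z], and at
   [y] the coboundary of [f] agrees with that of its part at [z]. A bad [y]
   contains an edge between fat neighbours of a non-fat face; by trickling-down
   all links are spectral expanders, so bad faces are rare. Summing over [z] gives
   the bound. *)

(* The exponents of the thresholds double so that every grade costs the same. Multiplying the
   fatness conditions from grade [j + 1] up to grade [k] bounds the weight of the fat faces of grade
   [j + 1] by [||f|| / eta ^ (2 ^ (k - j) - 1)]. A bad face over a non-fat face of grade [j] pays a
   further [h_j = eta ^ (2 ^ (k - j))], which leaves one factor [eta] for every [j]. Carried down to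
   grade 0, the same product gives the exponent [2 ^ (k + 1) - 1] of the smallness hypothesis. The
   spectral error may not exceed any [h_j], hence the power [2 ^ k] in [lambda]; its factor 1/d pays
   for trickling down. The empty face must not be fat because neither local minimality nor local
   expansion says anything there. A bad face is charged once for each of its subsets; this
   multiplicity and the estimate of bad faces fix the constant in [eta]. The ratio (k+2)/(k+1-i) in
   [eps] arises when weights in links are turned into weights in [X]. Values at different faces lie
   in different groups, so orderings are first stripped off and cochains are handled as functions on
   unordered faces. *)
Require Import Defs.
From mathcomp Require classical_sets.
From mathcomp Require Import ring lra zify.

Set Implicit Arguments.
Unset Strict Implicit.
Unset Printing Implicit Defensive.

Import Order.TTheory GRing.Theory Num.Theory.
Local Open Scope ring_scope.

(** * Bounding a symmetric form by its real eigenvalues *)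

Section QuadraticForms.
Variable R : realType.

Lemma qformE n (M : 'M[R]_n) (x y : 'rV[R]_n) :
  (x *m M *m y^T) 0 0 = \sum_i \sum_j M i j * x 0 i * y 0 j.
Proof.
rewrite mxE exchange_big /=; apply: eq_bigr => j _; rewrite !mxE mulr_suml.
by apply: eq_bigr => i _; rewrite [x 0 i * _]mulrC.
Qed.

Lemma qform_le_bound n (M : 'M[R]_n) : exists2 C : R, 0 < C &
  forall x : 'rV[R]_n, (x *m M *m x^T) 0 0 <= C * \sum_i x 0 i ^+ 2.
Proof.
(* Any crude bound will do; the 1 makes it positive, so that it can be divided by. *)
exists (1 + \sum_i \sum_j `|M i j|).
  by rewrite ltr_pwDl // sumr_ge0 // => i _; rewrite sumr_ge0.
move=> x; set N := \sum_i x 0 i ^+ 2.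
have N0 : 0 <= N by apply: sumr_ge0 => i _; exact: sqr_ge0.
have leN i : x 0 i ^+ 2 <= N.
  by rewrite /N (bigD1 i) //= lerDl; apply: sumr_ge0 => j _; exact: sqr_ge0.
rewrite qformE mulrDl mul1r ler_wpDl // mulr_suml ler_sum // => i _.
rewrite mulr_suml ler_sum // => j _; rewrite -mulrA.
apply: (le_trans (ler_norm _)); rewrite normrM ler_wpM2l //.
have := leN i; have := leN j; rewrite ler_norml => hi hj.
have h1 := sqr_ge0 (x 0 i + x 0 j); have h2 := sqr_ge0 (x 0 i - x 0 j).
by apply/andP; split; nra.
Qed.

(* Test positivity at [x - t x P^-1] with [t] small. *)
Lemma psd_unit_coercive n (P : 'M[R]_n) : P^T = P -> P \in unitmx ->
  (forall x : 'rV[R]_n, 0 <= (x *m P *m x^T) 0 0) ->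
  exists2 c : R, 0 < c &
    forall x : 'rV[R]_n, c * \sum_i x 0 i ^+ 2 <= (x *m P *m x^T) 0 0.
Proof.
move=> symP uP psd; have [C C0 hC] := qform_le_bound (invmx P).
exists C^-1; first by rewrite invr_gt0.
move=> x; pose y := x *m invmx P; set N := \sum_i x 0 i ^+ 2.
have NE : (x *m x^T) 0 0 = N.
  by rewrite mxE; apply: eq_bigr => i _; rewrite mxE expr2.
have yP : y *m P = x by rewrite mulmxKV.
have Py : P *m y^T = x^T by rewrite -[P in LHS]symP -trmx_mul yP.
have subE (A B : 'M[R]_1) : (A - B) 0 0 = A 0 0 - B 0 0 by rewrite !mxE.
have scaleE a (A : 'M[R]_1) : (a *: A) 0 0 = a * A 0 0 by rewrite mxE.
have xy : (x *m y^T) 0 0 = (y *m x^T) 0 0.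
  by rewrite -[LHS]trace_mx11 -mxtrace_tr trmx_mul trmxK trace_mx11.
(* Here [t = C^-1]. The form at this point is [x P x^T - 2 t N + t^2 x P^-1 x^T], and the last term
   is at most [t N]. *)
have := psd (x - C^-1 *: y).
rewrite [(_ - _)^T]linearB /= [(_ *: _)^T]linearZ /= mulmxBl.
rewrite -scalemxAl yP mulmxBr !mulmxBl.
rewrite -!scalemxAr -!scalemxAl -[x *m P *m y^T]mulmxA Py.
rewrite !(subE, scaleE) xy NE.
have := hC x; rewrite -/y -/N => h1.
have h2 : C^-1 * (C^-1 * (y *m x^T) 0 0) <= C^-1 * N.
  by rewrite ler_pM2l ?invr_gt0 // mulrC ler_pdivrMr // mulrC.
by move: h2; set a := C^-1 * N; set b := C^-1 * (C^-1 * _); lra.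
Qed.

(** Take the least admissible bound [t >= hi]. If [t > hi], then [t *: diag_mx m - K] is positive
    semidefinite and, [t] not being an eigenvalue, invertible; so it is coercive and [t] could be
    lowered. *)
Lemma qform_le_of_eigen n (K : 'M[R]_n) (m : 'rV[R]_n) (hi : R) :
  K^T = K -> (forall i, 0 < m 0 i) ->
  (forall mu (x : 'rV[R]_n), x != 0 -> x *m K = mu *: (x *m diag_mx m) ->
     mu <= hi) ->
  forall x : 'rV[R]_n,
    (x *m K *m x^T) 0 0 <= hi * \sum_i m 0 i * x 0 i ^+ 2.
Proof.
move=> symK m0 eig.
pose E (x : 'rV[R]_n) := \sum_i m 0 i * x 0 i ^+ 2.
have E0 x : 0 <= E x.
  by apply: sumr_ge0 => i _; rewrite mulr_ge0 ?sqr_ge0 // ltW.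
pose S : classical_sets.set R := fun t =>
  hi <= t /\ forall x, (x *m K *m x^T) 0 0 <= t * E x.
have [c [c0 hc]] : exists c : R, 0 < c /\ forall i, c <= m 0 i.
  exists (\big[Num.min/1]_i m 0 i); split.
    by elim/big_ind: _ => // a b a0 b0; rewrite lt_min a0.
  by move=> i; rewrite bigmin_le // orbC lexx.
have EN (x : 'rV[R]_n) : c * (\sum_i x 0 i ^+ 2) <= E x.
  by rewrite mulr_sumr ler_sum // => i _; rewrite ler_wpM2r ?sqr_ge0.
have N0 (x : 'rV[R]_n) : 0 <= \sum_i x 0 i ^+ 2.
  by apply: sumr_ge0 => i _; exact: sqr_ge0.
have Sne : classical_sets.nonempty S.
  have [C C0 hC] := qform_le_bound K.
  exists (Num.max hi (C / c)); split; first by rewrite le_max lexx.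
  move=> x; apply: (le_trans (hC x)).
  apply: (@le_trans _ _ (C / c * E x)).
    rewrite -mulrA ler_pM2l // mulrC ler_pdivlMr // mulrC; exact: EN.
  by rewrite ler_wpM2r // le_max lexx orbT.
have Slb : classical_sets.has_lbound S by exists hi => t [].
set t := inf S.
have ht : hi <= t by apply: lb_le_inf => // s [].
have tS (x : 'rV[R]_n) : (x *m K *m x^T) 0 0 <= t * E x.
  have [Ex0|Ex0] := eqVneq (E x) 0.
    by have [s [_ /(_ x)]] := Sne; rewrite Ex0 !mulr0.
  have Exp : 0 < E x by rewrite lt_def Ex0 E0.
  rewrite -ler_pdivrMr //; apply: lb_le_inf => // s [_ /(_ x)].
  by rewrite ler_pdivrMr.
suff -> : hi = t by exact: tS.
apply/eqP; rewrite eq_le ht /=; rewrite leNgt; apply/negP => hit.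
pose P := t *: diag_mx m - K.
have diagE (x : 'rV[R]_n) : (x *m diag_mx m *m x^T) 0 0 = E x.
  rewrite mxE; apply: eq_bigr => i _; rewrite mul_mx_diag !mxE; ring.
have PE (x : 'rV[R]_n) : (x *m P *m x^T) 0 0 = t * E x - (x *m K *m x^T) 0 0.
  rewrite /P mulmxBr mulmxBl -scalemxAr -scalemxAl -diagE.
  by rewrite [LHS]mxE [X in X + _]mxE [X in _ + X]mxE.
have psd (x : 'rV[R]_n) : 0 <= (x *m P *m x^T) 0 0 by rewrite PE subr_ge0.
have symP : P^T = P by rewrite /P linearB linearZ /= tr_diag_mx symK.
have uP : P \in unitmx.
  rewrite unitmxE unitfE; apply/negP => /det0P[x x0 xP].
  suff : t <= hi by rewrite leNgt hit.
  apply: (eig t x x0); apply/eqP; rewrite eq_sym -subr_eq0 scalemxAr -mulmxBr.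
  by rewrite -/P xP.
have [a a0 ha] := psd_unit_coercive symP uP psd.
have [b b0 hb] := qform_le_bound (diag_mx m).
have ab0 : 0 < a / b by rewrite divr_gt0.
(* As [b] bounds the weighted square norm by the plain one, coercivity leaves a margin [a / b]; the
   maximum keeps [s] in [S]. *)
pose s := Num.max hi (t - a / b).
have : t <= s.
  apply: ge_inf => //; split; first by rewrite le_max lexx.
  move=> x; apply: (@le_trans _ _ ((t - a / b) * E x)); last first.
    by rewrite ler_wpM2r // le_max lexx orbT.
  have h1 : a / b * E x <= a * \sum_i x 0 i ^+ 2.
    rewrite -mulrA ler_pM2l // mulrC ler_pdivrMr // mulrC -diagE; exact: hb.
  have := ha x; rewrite PE; move: h1.
  by rewrite mulrBl; set q1 := _ * E x; set q2 := a * _; lra.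
by rewrite le_max leNgt hit /= leNgt gtrBl ab0.
Qed.

Lemma form_le_of_eigen (V : finType) (A : {set V}) (K : V -> V -> R)
    (m : V -> R) (hi : R) :
  (forall u v, K u v = K v u) -> {in A, forall v, 0 < m v} ->
  (forall mu (f : V -> R), (exists2 v, v \in A & f v != 0) ->
     {in A, forall v, \sum_(u in A) K v u * f u = mu * (m v * f v)} ->
     mu <= hi) ->
  forall f : V -> R,
    \sum_(v in A) \sum_(u in A) K v u * f v * f u
      <= hi * \sum_(v in A) m v * f v ^+ 2.
Proof.
move=> symK m0 eig f.
pose KM : 'M[R]_#|A| := \matrix_(i, j) K (enum_val i) (enum_val j).
pose mM : 'rV[R]_#|A| := \row_i m (enum_val i).
pose x : 'rV[R]_#|A| := \row_i f (enum_val i).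
have -> : \sum_(v in A) \sum_(u in A) K v u * f v * f u = (x *m KM *m x^T) 0 0.
  rewrite qformE big_enum_val; apply: eq_bigr => i _.
  by rewrite big_enum_val; apply: eq_bigr => j _; rewrite !mxE.
have -> : \sum_(v in A) m v * f v ^+ 2 = \sum_i mM 0 i * x 0 i ^+ 2.
  by rewrite big_enum_val; apply: eq_bigr => i _; rewrite !mxE.
apply: qform_le_of_eigen.
- by apply/matrixP => i j; rewrite !mxE symK.
- by move=> i; rewrite mxE m0 // enum_valP.
move=> mu y y0 yE.
(* Extension of [y] by 0 outside [A]: each of these sums has at most one term. *)
pose g v := \sum_(i | enum_val i == v) y 0 i.
have gE i : g (enum_val i) = y 0 i.
  rewrite /g (big_pred1 i) // => j; exact: (inj_eq enum_val_inj).
apply: (eig mu g).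
  have /existsP[i yi] : [exists i, y 0 i != 0].
    apply: contraR y0; rewrite negb_exists => /forallP y0.
    by apply/eqP/rowP => i; have := y0 i; rewrite negbK mxE => /eqP.
  by exists (enum_val i); rewrite ?enum_valP // gE.
move=> v vA; rewrite -(enum_rankK_in vA vA) gE.
move/rowP/(_ (enum_rank_in vA v)): yE; rewrite mul_mx_diag !mxE => yE.
rewrite big_enum_val [m _ * _]mulrC -yE; apply: eq_bigr => i _.
by rewrite gE mxE symK mulrC.
Qed.

End QuadraticForms.

(** * Canonical weights: incidence sums and weights in links *)

Section WeightIdentities.
Variables (R : realType) (V : finType) (X : {set {set V}}) (d : nat).
Hypothesis hX : is_dcomplex d X.
Implicit Types (x y z u : {set V}).

Local Notation w := (weight R d X).
Local Notation deg x := #|[set t in faces X d.+1 | x \subset t]|.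

(** Both sides run over the flags [u \subset v |: u], listed by the smaller or by the larger set. *)
Lemma sum_setU1 (A : nmodType) (G : {set V} -> V -> A) :
  \sum_(u : {set V}) \sum_(v | v \notin u) G u v =
  \sum_(x : {set V}) \sum_(v in x) G (x :\ v) v.
Proof.
rewrite (exchange_big_dep xpredT) //= [RHS](exchange_big_dep xpredT) //=.
apply: eq_bigr => v _.
rewrite (reindex_onto (fun x => x :\ v) (fun u => v |: u)) /=; last first.
  by move=> u vu; rewrite setU1K.
apply: eq_bigl => x; rewrite !inE eqxx /=.
by apply/eqP/idP => [e|vx]; [rewrite -e setU11 | rewrite setD1K].
Qed.

Lemma subset_in_complex x y : y \in X -> x \subset y -> x \in X.
Proof. by case: hX => _ h _; apply: h. Qed.

Lemma deg_gt0 x : (0 < deg x)%N = (x \in X).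
Proof.
apply/card_gt0P/idP => [[t]|xX].
  by rewrite !inE => /andP[/andP[tX _] xt]; apply: subset_in_complex xt.
by case: hX => _ _ /(_ x xX)[t tX /andP[ct xt]]; exists t; rewrite !inE tX ct.
Qed.

Lemma card_face_le x : x \in X -> (#|x| <= d.+1)%N.
Proof.
case: hX => _ _ h /h[t _ /andP[/eqP <- xt]]; exact: subset_leq_card.
Qed.

Lemma facets_gt0 : (0 < #|faces X d.+1|)%N.
Proof.
have : (0 < deg set0)%N by rewrite deg_gt0; case: hX.
by move/leq_trans; apply; apply: subset_leq_card; apply/subsetP=> t /setIdP[].
Qed.

Lemma deg_setU1 u :
  (\sum_(v | v \notin u) deg (v |: u) = (d.+1 - #|u|) * deg u)%N.
Proof.
under eq_bigr do rewrite -sum1_card.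
rewrite (exchange_big_dep (fun t => t \in [set t in faces X d.+1 | u \subset t])) /=.
  rewrite -[deg u]sum1_card big_distrr /=; apply: eq_bigr => t.
  rewrite !inE => /andP[/andP[tX /eqP ct] ut]; rewrite muln1 sum1dep_card.
  rewrite -ct -(cardsDS ut); congr #|pred_of_set _|; apply/setP=> v.
  by rewrite !inE tX ct eqxx /= subUset sub1set ut andbT.
by move=> v t _; rewrite !inE subUset => /andP[-> /andP[]].
Qed.

Lemma weight_ge0 x : 0 <= w x.
Proof. by rewrite /weight !mulr_ge0 ?invr_ge0. Qed.

Lemma weight_gt0 x : x \in X -> 0 < w x.
Proof.
move=> xX; rewrite /weight !mulr_gt0 ?invr_gt0 ?ltr0n ?deg_gt0 ?facets_gt0 //.
by rewrite bin_gt0 card_face_le.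
Qed.

Lemma weight_eq0 x : x \notin X -> w x = 0.
Proof. by rewrite -deg_gt0 -eqn0Ngt /weight => /eqP ->; rewrite mulr0. Qed.

Lemma weight_set0 : w set0 = 1.
Proof.
rewrite /weight cards0 bin0 invr1 mul1r.
rewrite (_ : [set t in _ | _] = faces X d.+1) ?mulVf //.
  by rewrite pnatr_eq0 -lt0n facets_gt0.
by apply/setP=> t; rewrite !inE sub0set andbT.
Qed.

(** In each grade [w] is the law of a uniform subset of a uniform facet. Deleting a uniform vertex
    from a random face of grade [#|u|.+1] yields a random face of grade [#|u|]. *)
Lemma sum_weight_setU1 u : (#|u| <= d)%N ->
  \sum_(v | v \notin u) w (v |: u) = #|u|.+1%:R * w u.
Proof.
move=> ud.
have -> : \sum_(v | v \notin u) w (v |: u) = \sum_(v | v \notin u)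
    'C(d.+1, #|u|.+1)%:R^-1 * #|faces X d.+1|%:R^-1 * (deg (v |: u))%:R.
  by apply: eq_bigr => v vu; rewrite /weight cardsU1 vu add1n.
rewrite -mulr_sumr -natr_sum deg_setU1 natrM /weight.
have := mul_bin_left d.+1 #|u| => /(congr1 (fun n => n%:R : R)).
rewrite !natrM => h.
have c1 : 'C(d.+1, #|u|)%:R != 0 :> R.
  by rewrite pnatr_eq0 -lt0n bin_gt0 ltnW.
have c2 : 'C(d.+1, #|u|.+1)%:R != 0 :> R by rewrite pnatr_eq0 -lt0n bin_gt0.
have c3 : #|faces X d.+1|%:R != 0 :> R by rewrite pnatr_eq0 -lt0n facets_gt0.
move: h c1 c2 c3; set a := 'C(_, _)%:R; set b := 'C(_, _)%:R.
set c := #|faces _ _|%:R; set e := _%:R; set f := _%:R; set g := _%:R.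
move=> h b0 a0 c0; apply: (mulfI a0); apply: (mulfI b0); apply: (mulfI c0).
transitivity (f * b * g); first by field; rewrite a0 c0.
by rewrite -h; field; rewrite b0 c0.
Qed.

Lemma sum_weight_sup u n : (#|u| <= n <= d.+1)%N ->
  \sum_(y : {set V} | (u \subset y) && (#|y| == n)) w y = 'C(n, #|u|)%:R * w u.
Proof.
case/andP=> un; have [m ->] : exists m, n = (#|u| + m)%N.
  by exists (n - #|u|)%N; rewrite subnKC.
elim: m => [|m IH] nd.
  rewrite addn0 binn mul1r (big_pred1 u) // => y /=; rewrite [y == u]eq_sym eqEcard.
  case: (boolP (u \subset y)) => //= uy.
  by rewrite eqn_leq (subset_leq_card uy) andbT.
set n' := (#|u| + m)%N in IH *.
have n'd : (n' <= d)%N by rewrite addnS in nd.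
have nz : m.+1%:R != 0 :> R by rewrite pnatr_eq0.
(* The factor [m.+1] counts the vertices of [y] outside [u]; deleting one of them leads to the
   induction hypothesis. *)
apply: (mulfI nz).
transitivity (\sum_(y : {set V} | (u \subset y) && (#|y| == n'.+1))
                \sum_(v in y :\: u) w y).
  rewrite mulr_sumr addnS; apply: eq_bigr => y /andP[uy /eqP cy].
  by rewrite sumr_const cardsDS // cy mulr_natl -addnS addKn.
transitivity (\sum_(y : {set V}) \sum_(v in y)
    (if (u \subset y :\ v) && (#|y :\ v| == n') then w (v |: (y :\ v)) else 0)).
  rewrite big_mkcond; apply: eq_bigr => y _.
  have [/andP[uy /eqP cy]|h] := ifPn.
    rewrite -big_mkcondr; apply: eq_big => [v|v /setDP[vy _]]; last first.
      by rewrite setD1K.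
    rewrite !inE subsetD1 uy [in RHS]andbC.
    case: (boolP (v \in y)) => [vy|]; rewrite ?andbF ?andbT //.
    have := cardsD1 v y; rewrite vy cy add1n => -[<-]; by rewrite eqxx andbT.
  rewrite big1 // => v vy; case: ifPn => // /andP[uy /eqP cy].
  by case/negP: h; rewrite (subset_trans uy (subsetDl _ _)) (cardsD1 v) vy cy eqxx.
rewrite -(@sum_setU1 _ (fun y v =>
  if (u \subset y) && (#|y| == n') then w (v |: y) else 0)).
transitivity (\sum_(y : {set V} | (u \subset y) && (#|y| == n')) n'.+1%:R * w y).
  rewrite [RHS]big_mkcond; apply: eq_bigr => y _.
  case: ifPn => [/andP[uy /eqP cy]|_]; last by rewrite big1.
  by rewrite sum_weight_setU1 cy.
rewrite -mulr_sumr IH ?leqW //; move: (w u) => W.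
rewrite !mulrA -!natrM; congr (_%:R * _).
rewrite addnS -/n' -[n']/(n'.+1.-1) mul_bin_down /= -/n'.
by rewrite /n' -addnS addKn.
Qed.

(** Both sides are the multinomial coefficient with parts [a], [b] and [n - (a + b)]. *)
Lemma bin_bin (n a b : nat) : (a + b <= n)%N ->
  ('C(n, a + b) * 'C(a + b, b) = 'C(n, b) * 'C(n - b, a))%N.
Proof.
move=> h; have hb : (b <= n)%N by lia.
have h1 := bin_fact h; have h2 := @bin_fact (a + b) b (leq_addl _ _).
have h3 := bin_fact hb; have ha : (a <= n - b)%N by lia.
have h4 := bin_fact ha; rewrite addnK in h2.
have e : (n - b - a = n - (a + b))%N by lia.
rewrite e in h4.
have f1 := fact_gt0 a; have f2 := fact_gt0 b; have f3 := fact_gt0 (n - (a + b)).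
have f0 : (0 < a`! * b`! * (n - (a + b))`!)%N by rewrite !muln_gt0 f1 f2 f3.
apply/eqP; rewrite -(eqn_pmul2r f0).
apply/eqP; transitivity n`!; nia.
Qed.

Lemma in_link z x : (x \in link X z) = (x :&: z == set0) && (x :|: z \in X).
Proof.
apply/imsetP/andP => [[y]|[/eqP xz xX]].
  rewrite inE => /andP[yX zy] ->; split; last first.
    by rewrite setDE setUIl [~: z :|: z]setUC setUCr setIT (setUidPl zy).
  by rewrite setDE -setIA [~: z :&: z]setIC setICr setI0.
exists (x :|: z); first by rewrite inE xX subsetUr.
rewrite setDUl setDv setU0; apply/esym/setDidPl.
by rewrite -setI_eq0 xz.
Qed.

Lemma setDUK z y : z \subset y -> (y :\: z) :|: z = y.
Proof.
move=> zy; rewrite setDE setUIl [~: z :|: z]setUC setUCr setIT.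
exact/setUidPl.
Qed.

Lemma setUDK z x : x :&: z = set0 -> (x :|: z) :\: z = x.
Proof.
by move=> xz; rewrite setDUl setDv setU0; apply/setDidPl; rewrite -setI_eq0 xz.
Qed.

Lemma card_setU_disj z x : x :&: z = set0 -> #|x :|: z| = (#|x| + #|z|)%N.
Proof. by move=> xz; rewrite cardsU xz cards0 subn0. Qed.

Lemma big_link_faces (A : nmodType) z n (P : pred {set V}) (G : {set V} -> A) :
  \sum_(x in faces (link X z) n | P x) G x =
  \sum_(y in faces X (n + #|z|) | (z \subset y) && P (y :\: z)) G (y :\: z).
Proof.
rewrite (reindex_onto (fun y => y :\: z) (fun x => x :|: z)) /=; last first.
  move=> x /andP[]; rewrite inE in_link => /andP[/andP[/eqP xz _] _] _.
  by rewrite setUDK.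
apply: eq_bigl => y; rewrite inE in_link [in RHS]inE.
have [zy|zy] /= := boolP (z \subset y); last first.
  rewrite andbF; apply/negbTE; rewrite negb_and orbC; apply/orP; left.
  by apply: contra zy => /eqP <-; rewrite subsetUr.
rewrite setDUK // eqxx andbT cardsDS // -(eqn_add2r #|z|) subnK ?subset_leq_card //.
by rewrite setDE -setIA [~: z :&: z]setIC setICr setI0 eqxx.
Qed.

Lemma deg_link z x : (#|z| <= d)%N -> x :&: z = set0 ->
  #|[set y in faces (link X z) (d - #|z|).+1 | x \subset y]| = deg (x :|: z).
Proof.
move=> zd xz; rewrite -[LHS]sum1_card -[RHS]sum1_card.
rewrite (eq_bigl (fun y =>
  (y \in faces (link X z) (d - #|z|).+1) && (x \subset y))); last first.
  by move=> y; rewrite inE.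
rewrite [LHS](@big_link_faces nat) addSn subnK //.
apply: eq_bigl => y; rewrite [RHS]inE subUset; apply: andb_id2l => yX.
rewrite andbC; apply: andb_id2r => zy.
by rewrite subsetD; apply: andb_idr => _; rewrite -setI_eq0 xz.
Qed.

(** The facets of the link are the facets of [X] through [z], so this is conditioning on [z]. The
    binomial counts the positions of [z] in a face of grade [#|x| + #|z|]. *)
Lemma weight_link z x : z \in X -> (#|z| <= d)%N -> x \in link X z ->
  weight R (d - #|z|) (link X z) x =
  w (x :|: z) / ('C(#|x| + #|z|, #|z|)%:R * w z).
Proof.
move=> zX zd; rewrite in_link => /andP[/eqP xz xX].
rewrite /weight deg_link //.
have -> : #|faces (link X z) (d - #|z|).+1| = deg z.
  rewrite -[in RHS](set0U z) -deg_link ?set0I //; congr #|pred_of_set _|.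
  by apply/setP=> y; rewrite !inE sub0set andbT.
rewrite card_setU_disj //.
have le : (#|x| + #|z| <= d.+1)%N.
  by have := card_face_le xX; rewrite card_setU_disj.
have := bin_bin le => /(congr1 (fun n => n%:R : R)).
rewrite !natrM subSn // => h.
have c1 : 'C(d.+1, #|x| + #|z|)%:R != 0 :> R.
  by rewrite pnatr_eq0 -lt0n bin_gt0.
have c2 : 'C(d.+1, #|z|)%:R != 0 :> R by rewrite pnatr_eq0 -lt0n bin_gt0 ltnW.
have c3 : #|faces X d.+1|%:R != 0 :> R by rewrite pnatr_eq0 -lt0n facets_gt0.
have c4 : (deg z)%:R != 0 :> R by rewrite pnatr_eq0 -lt0n deg_gt0.
have c5 : 'C(#|x| + #|z|, #|z|)%:R != 0 :> R.
  by rewrite pnatr_eq0 -lt0n bin_gt0 leq_addl.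
have c6 : 'C((d - #|z|).+1, #|x|)%:R != 0 :> R.
  by rewrite pnatr_eq0 -lt0n bin_gt0; lia.
move: h c1 c2 c3 c4 c5 c6.
set a := 'C(d.+1, _)%:R; set b := 'C(d.+1, _)%:R.
set c := #|faces _ _|%:R; set e := 'C(_, _)%:R; set f := 'C(_, _)%:R.
set g := _%:R; set l := _%:R.
move=> h a0 b0 c0 g0 e0 f0.
have -> : f = a * e / b by rewrite h mulrC mulKf.
by field; rewrite a0 b0 c0 g0 e0.
Qed.

Lemma sum_link_weight z n (P : pred {set V}) : z \in X -> (#|z| <= d)%N ->
  \sum_(x in faces (link X z) n | P x) weight R (d - #|z|) (link X z) x =
  ('C(n + #|z|, #|z|)%:R * w z)^-1 *
    \sum_(y in faces X (n + #|z|) | (z \subset y) && P (y :\: z)) w y.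
Proof.
move=> zX zd; rewrite big_link_faces mulr_sumr; apply: eq_bigr => y.
case/and3P; rewrite inE => /andP[yX /eqP cy] zy _.
rewrite weight_link // ?setDUK //; last first.
  by rewrite in_link setDUK // yX setDE -setIA [~: z :&: z]setIC setICr setI0 eqxx.
rewrite cardsDS // cy addnK mulrC; congr (_ * _).
Qed.

Lemma sum_faces_weight_sup u n : (#|u| <= n <= d.+1)%N ->
  \sum_(y in faces X n | u \subset y) w y = 'C(n, #|u|)%:R * w u.
Proof.
move=> h; rewrite -sum_weight_sup //.
rewrite big_mkcond [RHS]big_mkcond; apply: eq_bigr => y _.
rewrite inE; case: (boolP (y \in X)) => [yX|yX] /=; first by rewrite andbC.
by rewrite weight_eq0 // if_same.
Qed.

Lemma sum_link_weight1 z n : z \in X -> (#|z| <= d)%N -> (n + #|z| <= d.+1)%N ->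
  \sum_(x in faces (link X z) n) weight R (d - #|z|) (link X z) x = 1.
Proof.
move=> zX zd nd.
transitivity (\sum_(x in faces (link X z) n | xpredT x)
                weight R (d - #|z|) (link X z) x).
  by apply: eq_bigl => x; rewrite andbT.
rewrite sum_link_weight //.
rewrite (eq_bigl (fun y => (y \in faces X (n + #|z|)) && (z \subset y))); last first.
  by move=> y; rewrite andbT.
rewrite sum_faces_weight_sup ?leq_addl // mulVf // mulf_neq0 //.
  by rewrite pnatr_eq0 -lt0n bin_gt0 leq_addl.
by rewrite gt_eqF // weight_gt0.
Qed.

End WeightIdentities.

(** * Trickling down of spectral expansion *)

Section Trickling.
Variables (R : realType) (V : finType) (X : {set {set V}}) (d : nat).
Hypothesis hX : is_dcomplex d X.
Implicit Types (x y z u : {set V}) (f g : V -> R).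

Local Notation w := (weight R d X).

(** The vertex weights of the link of [u], up to the constant [#|u|.+1%:R * w u]. Extension by 0
    lets sums run over all of [V], and avoids handling the link as a complex. *)
Definition vweight u v : R := if v \notin u then w (v |: u) else 0.

(** The edge weights of the link of [u], likewise not normalized. They form a symmetric matrix, so
    each edge occurs twice in a double sum. *)
Definition eweight u v v' : R :=
  if [&& v \notin u, v' \notin u & v != v'] then w (v |: (v' |: u)) else 0.

(** After normalization: the adjacency operator of the link is at most [l] plus [1 - l] times the
    projection to the constants. The factor [#|u|.+2] comes from the row sums of [eweight], and
    [#|u|.+1%:R * w u] is the total of [vweight]. *)
Definition form_bound u (l : R) : Prop := forall f,
  \sum_v \sum_v' eweight u v v' * f v * f v' <=
  #|u|.+2%:R * (l * (\sum_v vweight u v * f v ^+ 2)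
    + (1 - l) * ((\sum_v vweight u v * f v) ^+ 2 / (#|u|.+1%:R * w u))).

Definition eigen_bound u (hi : R) : Prop := forall mu f,
  \sum_v vweight u v * f v = 0 ->
  (exists2 v, vweight u v != 0 & f v != 0) ->
  (forall v, vweight u v != 0 ->
     \sum_v' eweight u v v' * f v' = mu * (#|u|.+2%:R * vweight u v * f v)) ->
  mu <= hi.

Lemma vweight_ge0 u v : 0 <= vweight u v.
Proof. by rewrite /vweight; case: ifP => // _; rewrite weight_ge0. Qed.

Lemma eweight_ge0 u v v' : 0 <= eweight u v v'.
Proof. by rewrite /eweight; case: ifP => // _; rewrite weight_ge0. Qed.

Lemma eweight_sym u v v' : eweight u v v' = eweight u v' v.
Proof. by rewrite /eweight [v' == v]eq_sym andbCA setUCA. Qed.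

Lemma vweight_neq0 u v : (vweight u v != 0) = (v \notin u) && (v |: u \in X).
Proof.
rewrite /vweight; case: ifP => vu /=; last by rewrite eqxx.
have [vX|vX] := boolP (_ \in X); first by rewrite gt_eqF // weight_gt0.
by rewrite weight_eq0 ?eqxx.
Qed.

Lemma eweightE u a v : a \notin u -> eweight u a v = vweight (a |: u) v.
Proof.
move=> au; rewrite /eweight /vweight au !inE negb_or [a == v]eq_sym /=.
by rewrite [a |: (v |: u)]setUCA; case: (v == a); case: (v \in u).
Qed.

Lemma sum_vweight u : (#|u| <= d)%N -> \sum_v vweight u v = #|u|.+1%:R * w u.
Proof. by move=> ud; rewrite -(sum_weight_setU1 _ hX) // [RHS]big_mkcond. Qed.

Lemma sum_eweight u v : (#|u| < d)%N ->
  \sum_v' eweight u v v' = #|u|.+2%:R * vweight u v.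
Proof.
move=> ud; have [vu|vu] := boolP (v \in u).
  by rewrite /eweight /vweight vu mulr0 big1.
under eq_bigr do rewrite eweightE //.
by rewrite sum_vweight ?cardsU1 ?vu // /vweight vu.
Qed.

Lemma eweight_eq0 u v v' : vweight u v = 0 -> eweight u v v' = 0.
Proof.
move/eqP; apply: contraTeq; rewrite vweight_neq0 /eweight.
case: ifP => [/and3P[-> _ _] /= h|]; last by rewrite eqxx.
apply: (contraNT _ h) => vX; rewrite weight_eq0 //.
by apply: contra vX => h'; apply: (subset_in_complex hX h'); rewrite setUS // subsetUr.
Qed.

Lemma sum_eweight_setU1 u v v' : (#|u|.+1 < d)%N ->
  \sum_(a | a \notin u) eweight (a |: u) v v' = #|u|.+3%:R * eweight u v v'.
Proof.
move=> ud; rewrite [in RHS]/eweight.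
case: ifPn => [/and3P[vu v'u vv']|h]; last first.
  rewrite mulr0 big1 // => a au; rewrite /eweight ifN //.
  by apply: contra h; rewrite !inE !negb_or => /and3P[/andP[_ ->] /andP[_ ->] ->].
have c : #|v |: (v' |: u)| = #|u|.+2.
  by rewrite !cardsU1 !inE negb_or vu v'u vv'.
have := @sum_vweight (v |: (v' |: u)); rewrite c => <- //.
rewrite [LHS]big_mkcond; apply: eq_bigr => a _.
rewrite /eweight /vweight !inE !negb_or vu v'u vv' !andbT.
rewrite [v == a]eq_sym [v' == a]eq_sym.
case: (a \in u); rewrite /= ?andbF //= andbT.
by case: ifP => // _; rewrite [v' |: (a |: u)]setUCA [v |: (a |: _)]setUCA.
Qed.

(* Subtracting a multiple of the rank-one form [(\sum_v vweight u v * f v) ^+ 2]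
   gives the constants the eigenvalue [hi] and does not change the form on the
   mean-zero functions, so no restriction to a subspace is needed. *)
Lemma form_bound_of_eigen u hi : u \in X -> (#|u| < d)%N ->
  eigen_bound u hi -> form_bound u hi.
Proof.
move=> uX ud eig f.
have T0 : 0 < #|u|.+1%:R * w u by rewrite mulr_gt0 ?weight_gt0.
have j0 : 0 < #|u|.+2%:R :> R by rewrite ltr0n.
set T := _ * w u in T0 *; set j := #|u|.+2%:R in j0 *.
pose c := (1 - hi) * j / T.
pose A := [set v | vweight u v != 0].
pose K v v' := eweight u v v' - c * vweight u v * vweight u v'.
have sumA (G : V -> R) : (forall v, vweight u v = 0 -> G v = 0) ->
    \sum_(v in A) G v = \sum_v G v.
  move=> G0; rewrite big_mkcond; apply: eq_bigr => v _.
  by rewrite inE; case: eqP => //= /G0.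
have K0 v v' : vweight u v = 0 -> K v v' = 0.
  by move=> v0; rewrite /K eweight_eq0 // v0 mulr0 mul0r subr0.
have symK v v' : K v v' = K v' v by rewrite /K eweight_sym mulrAC.
have := @form_le_of_eigen R V A K (fun v => j * vweight u v) hi symK.
have m0 : {in A, forall v, 0 < j * vweight u v}.
  by move=> v; rewrite inE => v0; rewrite mulr_gt0 // lt_def v0 vweight_ge0.
move=> /(_ m0).
have rowE v g : \sum_(v' in A) K v v' * g v' =
    \sum_v' eweight u v v' * g v' - c * vweight u v * \sum_v' vweight u v' * g v'.
  rewrite sumA => [|v' v'0]; last by rewrite symK K0 // mul0r.
  rewrite mulr_sumr -sumrB; apply: eq_bigr => v' _; rewrite /K; ring.
have eigK mu g : (exists2 v, v \in A & g v != 0) ->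
    {in A, forall v, \sum_(v' in A) K v v' * g v' = mu * (j * vweight u v * g v)} ->
    mu <= hi.
  move=> [v vA gv] gE.
  have E v0 : \sum_v' eweight u v0 v' * g v'
      - c * vweight u v0 * (\sum_v' vweight u v' * g v')
      = mu * (j * vweight u v0 * g v0).
    have [v0A|] := boolP (v0 \in A); first by rewrite -gE // rowE.
    rewrite inE negbK => /eqP v00; rewrite v00 !(mulr0, mul0r) subr0.
    by apply: big1 => v' _; rewrite eweight_eq0 // mul0r.
  have sumE : (j - c * T) * (\sum_v' vweight u v' * g v')
      = mu * j * (\sum_v' vweight u v' * g v').
    have : \sum_v0 (\sum_v' eweight u v0 v' * g v'
        - c * vweight u v0 * (\sum_v' vweight u v' * g v'))
      = \sum_v0 mu * (j * vweight u v0 * g v0) by apply: eq_bigr => v0 _; exact: E.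
    rewrite sumrB exchange_big /= -mulr_suml -mulr_sumr sum_vweight ?(ltnW ud) // -/T.
    have -> : \sum_v0 \sum_v' eweight u v' v0 * g v0 = j * \sum_v' vweight u v' * g v'.
      rewrite mulr_sumr; apply: eq_bigr => v0 _; rewrite -mulr_suml.
      under eq_bigr do rewrite eweight_sym.
      by rewrite sum_eweight // mulrA.
    move=> h; rewrite mulrBl h mulr_sumr; apply: eq_bigr => v0 _; ring.
  (* By [sumE] and the choice of [c], an eigenfunction of nonzero mean has eigenvalue exactly
     [hi]. *)
  have [M0|M0] := eqVneq (\sum_v' vweight u v' * g v') 0.
    apply: (eig mu g M0); first by exists v; rewrite ?inE // in vA *.
    by move=> v0 _; rewrite -E M0 mulr0 subr0.
  move/(mulIf M0): sumE; rewrite /c divfK ?gt_eqF //.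
  have -> : j - (1 - hi) * j = hi * j by ring.
  by move/(mulIf (lt0r_neq0 j0)) => ->.
move=> /(_ eigK f).
rewrite sumA => [|v v0]; last first.
  by apply: big1 => v' _; rewrite K0 // !mul0r.
have -> : \sum_v \sum_(v' in A) K v v' * f v * f v' =
    \sum_v \sum_v' eweight u v v' * f v * f v' - c * (\sum_v vweight u v * f v) ^+ 2.
  rewrite expr2 mulrA [c * _ * _]mulrC [c * _]mulr_sumr mulr_sumr -sumrB.
  apply: eq_bigr => v _.
  transitivity (f v * \sum_(v' in A) K v v' * f v').
    by rewrite mulr_sumr; apply: eq_bigr => v' _; ring.
  rewrite rowE mulrBr mulr_sumr; congr (_ - _); last by ring.
  by apply: eq_bigr => v' _; ring.
rewrite sumA => [|v ->]; last by rewrite mulr0 mul0r.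
have -> : \sum_v j * vweight u v * f v ^+ 2 = j * \sum_v vweight u v * f v ^+ 2.
  by rewrite mulr_sumr; apply: eq_bigr => v _; rewrite mulrA.
rewrite /c; set Q := \sum_v _; set S := \sum_v _; set M := \sum_v _.
rewrite lerBlDr => h; apply: (le_trans h); rewrite le_eqVlt; apply/orP; left.
apply/eqP; field; exact: lt0r_neq0.
Qed.

Lemma eigen_bound_of_spectral u lo hi : u \in X -> (#|u| < d)%N ->
  spectral_expander (d - #|u|) (link X u) lo hi -> eigen_bound u hi.
Proof.
move=> uX ud spec mu g mz [v1 v1X gv1] eig.
have ud' := ltnW ud.
have p1 : 1 + #|u|%:R != 0 :> R by rewrite gt_eqF // ltr_pwDl.
have p2 : 2 + #|u|%:R != 0 :> R by rewrite gt_eqF // ltr_pwDl.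
have wu : w u != 0 by rewrite gt_eqF // weight_gt0.
(* Any function that extends [g] from the singletons would do; the sum avoids choosing a vertex. *)
pose f x : R := \sum_(v in x) g v.
have f1 v : f [set v] = g v by rewrite /f big_set1.
have link1 v : ([set v] \in link X u) = (vweight u v != 0).
  rewrite in_link vweight_neq0 setI_eq0 disjoints1; congr (_ && _).
have w1 v : vweight u v != 0 ->
    weight R (d - #|u|) (link X u) [set v] = vweight u v / (#|u|.+1%:R * w u).
  move=> v0; rewrite weight_link ?link1 // cards1 add1n binSn.
  by move: v0; rewrite vweight_neq0 /vweight => /andP[-> _].
suff /andP[] : lo <= mu <= hi by [].
have sum1 (G : {set V} -> R) :
    \sum_(x in faces (link X u) 1) G x = \sum_(v | vweight u v != 0) G [set v].
  transitivity (\sum_(x in (fun v => [set v]) @: [set v | vweight u v != 0]) G x).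
    apply: eq_bigl => x; rewrite inE; apply/andP/imsetP => [[xX /cards1P[v xv]]|[v]].
      by exists v => //; rewrite inE -link1 -xv.
    by rewrite inE -link1 => vX ->; rewrite vX cards1.
  rewrite big_imset /=; last by move=> a b _ _; exact: set1_inj.
  by apply: eq_bigl => v; rewrite inE.
apply: (spec mu f).
- rewrite /mean_zero sum1.
  transitivity ((#|u|.+1%:R * w u)^-1 * \sum_v vweight u v * g v); last first.
    by rewrite mz mulr0.
  rewrite mulr_sumr big_mkcond; apply: eq_bigr => v _; case: ifPn => v0.
    by rewrite w1 // f1 mulrAC mulrC.
  by move: v0; rewrite negbK => /eqP ->; rewrite mul0r mulr0.
- by exists [set v1]; rewrite ?f1 // inE link1 v1X cards1.
move=> x; rewrite inE => /andP[xX /cards1P[v xv]].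
rewrite {x}xv in xX *; rewrite link1 in xX; rewrite /adjacency f1.
have vu : v \notin u by move: xX; rewrite vweight_neq0 => /andP[].
transitivity (\sum_(v' | eweight u v v' != 0)
   eweight u v v' / (#|u|.+2%:R * vweight u v) * g v').
  transitivity (\sum_(e in (fun v' => [set v; v']) @: [set v' | eweight u v v' != 0])
     weight R (d - #|u|) (link X u) e / (2 * weight R (d - #|u|) (link X u) [set v])
       * f (e :\: [set v])).
    apply: eq_bigl => e; rewrite inE sub1set.
    apply/andP/imsetP => [[/andP[eX /cards2P[a [b [ab eE]]]] ve]|[v']].
      have [v' [vv' eE']] : exists v', v != v' /\ e = [set v; v'].
        move: ve; rewrite eE !inE => /orP[]/eqP ->; first by exists b.
        by exists a; rewrite eq_sym setUC.
      exists v' => //; rewrite inE /eweight vv' vu.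
      move: eX; rewrite in_link eE' setIUl setU_eq0 !setI_eq0 !disjoints1.
      case/andP=> /andP[_ v'u] eX; rewrite v'u /= setUA gt_eqF // weight_gt0 //.
    rewrite inE /eweight; case: ifP => [/and3P[_ v'u vv'] w0 ->|]; last by rewrite eqxx.
    rewrite in_link setIUl setU_eq0 !setI_eq0 !disjoints1 vu v'u cards2 vv' !inE eqxx /=.
    split=> //; rewrite andbT -setUA; apply: contraNT w0 => /(weight_eq0 R hX) ->.
    by [].
  rewrite big_imset /=; last first.
    move=> a b; rewrite !inE => ha hb /setP E.
    have va : v != a.
      by move: ha; rewrite /eweight; case: ifP => [/and3P[]|]; rewrite ?eqxx.
    by have := E a; rewrite !inE eqxx orbT eq_sym (negPf va) => /esym/eqP.
  apply: eq_big => v'; rewrite inE // => e0.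
  have [v'u vv'] : v' \notin u /\ v != v'.
    by move: e0; rewrite /eweight; case: ifP => [/and3P[]|]; rewrite ?eqxx.
  have -> : [set v; v'] :\: [set v] = [set v'].
    apply/setP=> a; rewrite !inE; case: (eqVneq a v) => //= ->.
    by rewrite (negPf vv').
  rewrite f1 w1 // weight_link //; last first.
    rewrite in_link setIUl setU_eq0 !setI_eq0 !disjoints1 vu v'u /=.
    rewrite -setUA; apply: contraNT e0 => /(weight_eq0 R hX).
    by rewrite /eweight vu v'u vv' => ->.
  have -> : w ([set v; v'] :|: u) = eweight u v v'.
    by rewrite /eweight vu v'u vv' -setUA.
  rewrite cards2 vv' add2n.
  (* This 2 cancels the one in the definition of [adjacency]. *)
  have -> : 'C(#|u|.+2, #|u|)%:R = #|u|.+2%:R * #|u|.+1%:R / 2 :> R.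
    have := bin_sub (leq_addl 2 #|u|); rewrite addnK add2n => <-.
    have := mul_bin_diag #|u|.+2 1; rewrite bin1 /= => /(congr1 (fun n => n%:R : R)).
    by rewrite !natrM => ->; rewrite mulrC mulKf ?pnatr_eq0.
  congr (_ * _); field.
  by rewrite xX wu p1 p2.
transitivity ((#|u|.+2%:R * vweight u v)^-1 * \sum_v' eweight u v v' * g v').
  rewrite mulr_sumr big_mkcond; apply: eq_bigr => v' _; case: ifPn => e0.
    by rewrite mulrAC mulrC.
  by move: e0; rewrite negbK => /eqP ->; rewrite mul0r mulr0.
rewrite eig //; field; by rewrite xX p2.
Qed.

Lemma connect_const u f : connected_complex (link X u) ->
  (forall v v', eweight u v v' != 0 -> f v = f v') ->
  forall v v', vweight u v != 0 -> vweight u v' != 0 -> f v = f v'.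
Proof.
move=> conn fE v v'; rewrite !vweight_neq0 => /andP[vu vX] /andP[v'u v'X].
have in1 a : a \notin u -> a |: u \in X -> [set a] \in link X u.
  by move=> au aX; rewrite in_link setI_eq0 disjoints1 au.
have /connectP[p] := conn v v' (in1 _ vu vX) (in1 _ v'u v'X).
elim: p v {vu vX} => [|a p IH] v /=; first by move=> _ ->.
case/andP=> va pa v'E; rewrite -(IH a pa v'E).
have [-> //|neq] := eqVneq v a.
apply: fE; rewrite /eweight neq andbT.
move: va; rewrite /adj /= in_link setIUl setU_eq0 !setI_eq0 !disjoints1.
case/andP=> /andP[-> ->] /= vaX.
by rewrite setUA gt_eqF // weight_gt0.
Qed.

(* Oppenheim's trickling-down argument: localise an eigenfunction of the link
   of [u] to the links of [u + a] and average over [a]. *)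
Lemma eigen_bound_trickle u l : u \in X -> (#|u|.+1 < d)%N -> l < 1 ->
  connected_complex (link X u) ->
  (forall a, vweight u a != 0 -> form_bound (a |: u) l) ->
  eigen_bound u (l / (1 - l)).
Proof.
move=> uX ud l1 conn loc mu f mz [v0 v0X fv0] eig.
have ud1 := ltnW ud.
set j := #|u|.+2%:R in eig *; have j0 : 0 < j by rewrite ltr0n.
pose S := \sum_v vweight u v * f v ^+ 2.
have S0 : 0 < S.
  rewrite /S (bigD1 v0) //= ltr_pwDl //.
    by rewrite mulr_gt0 ?lt_def ?v0X ?vweight_ge0 // sqrf_eq0 fv0 sqr_ge0.
  by apply: sumr_ge0 => v _; rewrite mulr_ge0 ?vweight_ge0 ?sqr_ge0.
have row v : \sum_v' eweight u v v' * f v' = mu * (j * vweight u v * f v).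
  have [v0'|] := eqVneq (vweight u v) 0; last exact: eig.
  rewrite v0' mulr0 mul0r mulr0.
  by apply: big1 => v' _; rewrite eweight_eq0 // mul0r.
have QE : \sum_v \sum_v' eweight u v v' * f v * f v' = mu * j * S.
  rewrite /S mulr_sumr; apply: eq_bigr => v _.
  transitivity (f v * \sum_v' eweight u v v' * f v').
    by rewrite mulr_sumr; apply: eq_bigr => v' _; ring.
  rewrite row; ring.
have DE : \sum_v \sum_v' eweight u v v' * (f v - f v') ^+ 2 = 2 * (j * (1 - mu) * S).
  transitivity (\sum_v \sum_v' (eweight u v v' * f v ^+ 2 + eweight u v v' * f v' ^+ 2
       - 2 * (eweight u v v' * f v * f v'))).
    by apply: eq_bigr => v _; apply: eq_bigr => v' _; ring.
  under eq_bigr do rewrite sumrB big_split /= -mulr_sumr.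
  rewrite sumrB big_split /= -mulr_sumr QE.
  rewrite [X in _ + X - _]exchange_big /=.
  have -> : \sum_v \sum_v' eweight u v v' * f v ^+ 2 = j * S.
    rewrite /S mulr_sumr; apply: eq_bigr => v _.
    by rewrite -mulr_suml sum_eweight // mulrA.
  have -> : \sum_v \sum_v' eweight u v' v * f v ^+ 2 = j * S.
    rewrite /S mulr_sumr; apply: eq_bigr => v _.
    under eq_bigr do rewrite eweight_sym.
    by rewrite -mulr_suml sum_eweight // mulrA.
  ring.
(* Otherwise the energy in [DE] vanishes, [f] is constant by connectedness, and mean zero forces it
   to be 0. *)
have mu1 : mu < 1.
  rewrite ltNge; apply/negP => mu1.
  have t0 v v' : 0 <= eweight u v v' * (f v - f v') ^+ 2.
    by rewrite mulr_ge0 ?eweight_ge0 ?sqr_ge0.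
  have D0 : \sum_v \sum_v' eweight u v v' * (f v - f v') ^+ 2 = 0.
    apply/eqP; rewrite eq_le; apply/andP; split; last first.
      by apply: sumr_ge0 => v _; apply: sumr_ge0.
    rewrite DE pmulr_rle0 // pmulr_lle0 // pmulr_rle0 // subr_le0 //.
  have fE v v' : eweight u v v' != 0 -> f v = f v'.
    move=> e0; apply/eqP; rewrite -subr_eq0 -sqrf_eq0.
    move/eqP: D0; rewrite psumr_eq0 => [|a _]; last by apply: sumr_ge0.
    move/allP/(_ v (mem_index_enum _)) => /=; rewrite psumr_eq0 //.
    move/allP/(_ v' (mem_index_enum _)) => /=.
    by rewrite mulf_eq0 (negPf e0).
  have fc := connect_const conn fE.
  move: mz; have -> : \sum_v vweight u v * f v = (\sum_v vweight u v) * f v0.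
    rewrite mulr_suml; apply: eq_bigr => v _.
    have [->|v1] := eqVneq (vweight u v) 0; first by rewrite !mul0r.
    by rewrite (fc v v0).
  rewrite sum_vweight ?(ltnW ud1) // => /eqP.
  by rewrite mulf_eq0 (negPf fv0) orbF mulf_eq0 pnatr_eq0 /= gt_eqF // weight_gt0.
have main : mu * S <= (l + (1 - l) * mu ^+ 2) * S.
  have jj : 0 < #|u|.+3%:R :> R by rewrite ltr0n.
  have : #|u|.+3%:R * (mu * j * S) <=
      #|u|.+3%:R * (l * (j * S) + (1 - l) * (mu ^+ 2 * (j * S))).
    have -> : #|u|.+3%:R * (mu * j * S) =
        \sum_(a | a \notin u) \sum_v \sum_v' eweight (a |: u) v v' * f v * f v'.
      rewrite -QE mulr_sumr exchange_big /=; apply: eq_bigr => v _.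
      rewrite mulr_sumr exchange_big /=; apply: eq_bigr => v' _.
      by rewrite !mulrA -sum_eweight_setU1 // -!mulr_suml.
    have -> : #|u|.+3%:R * (l * (j * S) + (1 - l) * (mu ^+ 2 * (j * S))) =
        \sum_(a | a \notin u) #|u|.+3%:R * (l * (\sum_v vweight (a |: u) v * f v ^+ 2)
          + (1 - l) * (mu ^+ 2 * (j * (vweight u a * f a ^+ 2)))).
      rewrite -mulr_sumr big_split /= -!mulr_sumr.
      congr (_ * (_ * _ + _ * (_ * (_ * _)))).
        rewrite exchange_big /= /S mulr_sumr; apply: eq_bigr => v _.
        rewrite mulrA -sum_eweight // -mulr_suml; congr (_ * _).
        rewrite [RHS]big_mkcond; apply: eq_bigr => a _; rewrite eweight_sym.
        by case: ifPn => au; [exact: eweightE | rewrite /eweight (negPf au)].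
      rewrite /S [RHS]big_mkcond; apply: eq_bigr => a _.
      by rewrite /vweight; case: ifP => // _; rewrite mul0r.
    apply: ler_sum => a au.
    have [a0|a0] := eqVneq (vweight u a) 0.
      have a1 v : vweight (a |: u) v = 0 by rewrite -eweightE // eweight_eq0.
      rewrite a0 mul0r !mulr0 addr0 [X in _ <= X](_ : _ = 0); last first.
        by rewrite big1 ?mulr0 // => v _; rewrite a1 mul0r.
      rewrite big1 // => v _; apply: big1 => v' _.
      by rewrite eweight_eq0 // !mul0r.
    (* The eigenvalue equation at [a] evaluates the weighted sum of [f] over the link of [a |: u],
       so the mean term becomes a multiple of [f a ^+ 2]. *)
    have := loc a a0 f; rewrite cardsU1 au add1n.
    have -> : \sum_v vweight (a |: u) v * f v = mu * (j * vweight u a * f a).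
      by rewrite -row; apply: eq_bigr => v _; rewrite eweightE.
    have -> : w (a |: u) = vweight u a by rewrite /vweight au.
    rewrite (_ : _ ^+ 2 / _ = mu ^+ 2 * (j * (vweight u a * f a ^+ 2))) //.
    rewrite -/j; field; by rewrite a0 gt_eqF // ltr_pwDl.
  rewrite ler_pM2l //; nra.
(* Now [(1 - mu) * ((1 - l) * mu - l) <= 0], and the first factor is positive. *)
move: main; rewrite ler_pM2r // => main.
have l1' : 0 < 1 - l by rewrite subr_gt0.
rewrite ler_pdivlMr //; nra.
Qed.

(** One step down replaces [l] by [l / (1 - l)], and the [m]-th iterate of this map is
    [l / (1 - m l)]. *)
Lemma form_bound_local (lo l : R) : (0 < d)%N -> 0 <= l -> l * d%:R <= 1 ->
  strongly_connected d X -> local_spectral_expander d X d.-1 lo l ->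
  forall m u, u \in X -> (#|u| + m.+1 = d)%N ->
  form_bound u (l / (1 - m%:R * l)).
Proof.
move=> d0 l0 ld conn loc; elim=> [|m IH] u uX ud.
  rewrite mul0r subr0 divr1; have ud' : (#|u| < d)%N by lia.
  apply: form_bound_of_eigen => //; apply: (@eigen_bound_of_spectral _ lo) => //.
  by apply: loc; rewrite inE uX; apply/eqP; lia.
have ud' : (#|u| < d)%N by lia.
have md : (m.+2 <= d)%N by lia.
have lm : m.+1%:R * l < 1.
  have [->|ln0] := eqVneq l 0; first by rewrite mulr0.
  apply: lt_le_trans ld; rewrite mulrC ltr_pM2l ?ltr_nat //.
  by rewrite lt_def ln0.
have lm1 : m%:R * l + l < 1 by rewrite -[X in _ + X]mul1r -mulrDl natr1.
have lm0 : 0 < 1 - m%:R * l by lra.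
apply: form_bound_of_eigen => //.
have -> : l / (1 - m.+1%:R * l) = l / (1 - m%:R * l) / (1 - l / (1 - m%:R * l)).
  have -> : m.+1%:R = m%:R + 1 :> R by rewrite natr1.
  field; rewrite !gt_eqF //; lra.
apply: eigen_bound_trickle => //.
- lia.
- by rewrite ltr_pdivrMr // mul1r; lra.
- exact: conn.
move=> a; rewrite vweight_neq0 => /andP[au aX].
by apply: IH => //; rewrite cardsU1 au; lia.
Qed.

(** At most [d - 1] steps down are taken, and [l <= 1/d] keeps [1 - m l] at least [1/d]; so
    trickling costs a factor [d] at most. *)
Lemma link_form_le (lo l : R) u f : 0 <= l -> l * d%:R <= 1 ->
  strongly_connected d X -> local_spectral_expander d X d.-1 lo l ->
  u \in X -> (#|u| < d)%N ->
  \sum_v \sum_v' eweight u v v' * f v * f v' <=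
  #|u|.+2%:R * (d%:R * l * (\sum_v vweight u v * f v ^+ 2)
    + (\sum_v vweight u v * f v) ^+ 2 / (#|u|.+1%:R * w u)).
Proof.
move=> l0 ld conn loc uX ud.
have d0 : (0 < d)%N by lia.
have um : (#|u| + (d - #|u|.+1).+1 = d)%N by lia.
apply: (le_trans (form_bound_local d0 l0 ld conn loc uX um f)).
have dr : 0 < d%:R :> R by rewrite ltr0n.
have ml : (d - #|u|.+1)%:R * l <= 1 - d%:R^-1.
  apply: (@le_trans _ _ ((d%:R - 1) * l)).
    rewrite ler_wpM2r // -(natrB _ d0) ler_nat; lia.
  apply: (@le_trans _ _ ((d%:R - 1) / d%:R)); last first.
    by rewrite mulrBl mulfV ?mul1r ?gt_eqF.
  apply: ler_wpM2l; first by rewrite subr_ge0 ler1n.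
  by rewrite -[d%:R^-1]mul1r ler_pdivlMr.
have dV : 0 < d%:R^-1 :> R by rewrite invr_gt0.
set t := _ * l in ml *; have t0 : 0 < 1 - t by lra.
have lt : l / (1 - t) <= d%:R * l.
  rewrite ler_pdivrMr // mulrC mulrA -[X in X <= _]mul1r; apply: ler_wpM2r => //.
  rewrite -ler_pdivrMr // mul1r; lra.
rewrite ler_pM2l //; apply: lerD.
  apply: ler_wpM2r => //; apply: sumr_ge0 => v _.
  by rewrite mulr_ge0 ?vweight_ge0 ?sqr_ge0.
rewrite -[X in _ <= X]mul1r; apply: ler_wpM2r.
  by rewrite divr_ge0 ?sqr_ge0 // mulr_ge0 // weight_ge0.
by rewrite gerBl divr_ge0 // ltW.
Qed.

End Trickling.

(** * Signs of orderings of a finite vertex set *)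

Section OrderingSigns.
Variable V : finType.
Implicit Types (u v : V) (s t : seq V) (x y z : {set V}).

Definition pair_sign u v : int := Num.sg ((enum_rank v)%:Z - (enum_rank u)%:Z).

(* [(-1) ^+ n] for [n] the number of inversions of [t] along [enum_rank]. *)
Fixpoint ord_sign t : int :=
  if t is u :: t' then (\prod_(v <- t') pair_sign u v) * ord_sign t' else 1.

(** The usual coboundary sign: -1 to the position of [u] in [y] sorted by rank. *)
Definition del_sign u y : int := \prod_(v in y :\ u) pair_sign u v.

(** For disjoint [x] and [z], the sign of the shuffle that sorts [x] followed by [z], each already
    sorted. *)
Definition cross_sign x z : int := \prod_(u in x) \prod_(v in z) pair_sign u v.

Lemma pair_sign_anti u v : pair_sign v u = - pair_sign u v.
Proof. by rewrite /pair_sign -sgrN opprB. Qed.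

Lemma pair_sign_sq u v : u != v -> pair_sign u v * pair_sign u v = 1.
Proof.
move=> uv; rewrite -expr2 /pair_sign sqr_sg subr_eq0.
have -> // : ((enum_rank v)%:Z == enum_rank u) = false.
by apply/negbTE; apply: contra uv => /eqP[/ord_inj/enum_rank_inj ->].
Qed.

Lemma prod_sq1 (I : Type) (r : seq I) (P : pred I) (E : I -> int) :
  (forall i, P i -> E i * E i = 1) ->
  (\prod_(i <- r | P i) E i) * (\prod_(i <- r | P i) E i) = 1.
Proof. by move=> h; rewrite -big_split /= big1. Qed.

Lemma ord_sign_cat s t :
  ord_sign (s ++ t) =
  ord_sign s * (\prod_(u <- s) \prod_(v <- t) pair_sign u v) * ord_sign t.
Proof.
elim: s => [|u s IH] /=; first by rewrite big_nil !mul1r.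
rewrite IH big_cat big_cons /=; ring.
Qed.

Lemma ord_sign_sq t : uniq t -> ord_sign t * ord_sign t = 1.
Proof.
elim: t => [|u t IH] //= /andP[ut /IH h].
rewrite mulrACA h mulr1 big_seq; apply: prod_sq1 => v vt.
by apply: pair_sign_sq; apply: contra ut => /eqP ->.
Qed.

(** Moving [u] to the front crosses each entry of [s] once. This trades the position of [u] in an
    ordering, as in [cobd], for a sign that depends on the face only. *)
Lemma ord_sign_del s u t : uniq (s ++ u :: t) ->
  (-1) ^+ size s * ord_sign (s ++ t) =
  ord_sign (s ++ u :: t) * \prod_(v <- s ++ t) pair_sign u v.
Proof.
rewrite uniq_catC cat_cons /= mem_cat negb_or => /andP[/andP[ut us] _].
rewrite !ord_sign_cat /= big_cat /=.
have -> : \prod_(u0 <- s) \prod_(v <- u :: t) pair_sign u0 v =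
   (-1) ^+ size s * (\prod_(v <- s) pair_sign u v)
     * \prod_(u0 <- s) \prod_(v <- t) pair_sign u0 v.
  under eq_bigr do rewrite big_cons; rewrite big_split /=; congr (_ * _).
  elim: s {us} => [|v s IH]; first by rewrite !big_nil mulr1.
  rewrite !big_cons IH pair_sign_anti exprS; ring.
set a := (-1) ^+ _; set p := ord_sign s; set q := ord_sign t.
set c := \prod_(u0 <- s) \prod_(v <- t) _.
have e1 : (\prod_(v <- s) pair_sign u v) * (\prod_(v <- s) pair_sign u v) = 1.
  rewrite big_seq; apply: prod_sq1 => v vs.
  by apply: pair_sign_sq; apply: contra us => /eqP ->.
have e2 : (\prod_(v <- t) pair_sign u v) * (\prod_(v <- t) pair_sign u v) = 1.
  rewrite big_seq; apply: prod_sq1 => v vs.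
  by apply: pair_sign_sq; apply: contra ut => /eqP ->.
move: e1 e2; set b1 := \prod_(v <- s) _; set b2 := \prod_(v <- t) _ => e1 e2.
transitivity (a * (p * c * q) * (b1 * b1) * (b2 * b2)); last by ring.
by rewrite e1 e2 !mulr1.
Qed.

Fixpoint diff_prod (s : seq int) : int :=
  if s is a :: s' then (\prod_(b <- s') (b - a)) * diff_prod s' else 1.

Lemma diff_prodE (s : seq int) : diff_prod s =
  \prod_(i < size s) \prod_(j < size s | (i < j)%N) (s`_j - s`_i).
Proof.
elim: s => [|a s IH]; first by rewrite big_ord0.
rewrite /= big_ord_recl /=; congr (_ * _).
  rewrite [RHS]big_mkcond big_ord_recl /= mul1r (big_nth 0) big_mkord.
  by apply: eq_bigr.
rewrite IH; apply: eq_bigr => i _.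
by rewrite [RHS]big_mkcond big_ord_recl /= mul1r -big_mkcond.
Qed.

(* Both sides are signs of Vandermonde determinants. *)
Lemma ord_sign_perm n (t : n.-tuple V) (s : 'S_n) :
  ord_sign [tuple tnth t (s i) | i < n] = (-1) ^+ s * ord_sign t.
Proof.
pose a (t : n.-tuple V) : 'rV[int]_n := \row_i (enum_rank (tnth t i))%:Z.
have detE (t' : n.-tuple V) : ord_sign t' = Num.sg (\det (Vandermonde n (a t'))).
  pose r (u : V) : int := (enum_rank u)%:Z.
  transitivity (Num.sg (diff_prod (map r t'))).
    elim: (val t') => [|u s' IH] /=; first by rewrite sgr1.
    rewrite sgrM -IH; congr (_ * _); rewrite big_map.
    by rewrite (big_morph Num.sg (@sgrM _) (@sgr1 _)).
  rewrite diff_prodE det_Vandermonde size_map size_tuple.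
  congr (Num.sg _); apply: eq_bigr => i _; apply: eq_bigr => j _; rewrite !mxE.
  by rewrite !(nth_map (tnth t' i)) ?size_tuple // -!tnth_nth.
rewrite !detE.
have -> : Vandermonde n (a [tuple tnth t (s i) | i < n]) =
    col_perm s (Vandermonde n (a t)).
  by apply/matrixP=> i j; rewrite !mxE tnth_mktuple.
rewrite col_permE det_mulmx det_perm odd_permV mulrC sgrM; congr (_ * _).
by case: (odd_perm s); rewrite ?expr1 ?expr0 ?sgrN1 ?sgr1.
Qed.

Lemma mulrz_sq1_eq0 (A : zmodType) (a : A) (e : int) : e * e = 1 ->
  (a *~ e == 0) = (a == 0).
Proof.
move=> ee; apply/eqP/eqP => [h|->]; last by rewrite mul0rz.
by rewrite -[a]mulr1z -ee mulrzA h mul0rz.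
Qed.

End OrderingSigns.

(** * Cochains as functions on unordered faces *)

Section Orientation.
Variables (V : finType) (X : {set {set V}}) (F : aug_sheaf X).
Hypothesis subX : forall x y : {set V}, y \in X -> x \subset y -> x \in X.
Implicit Types (f g : cochain F) (x y z : {set V}) (t : seq V).

(** The value of a cochain at [x] sorted by rank; the sign factor makes this independent of the
    order that [enum] happens to use. *)
Definition orient f x : F x := f x (enum x) *~ ord_sign (enum x).

Definition face_cobd (phi : forall x, F x) y : F y :=
  \sum_(u in y) res F (y :\ u) y (phi (y :\ u)) *~ del_sign u y.

Lemma ordered_face_enum n x : x \in faces X n -> ordered_face X n x (enum x).
Proof.
rewrite inE => /andP[xX /eqP <-]; rewrite /ordered_face xX enum_uniq.
by rewrite -cardE eqxx set_enum eqxx.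
Qed.

Lemma ordered_faceP n x t : ordered_face X n x t ->
  [/\ x \in faces X n, size t = n, uniq t & [set u in t] = x].
Proof.
case/and4P=> xX /eqP st ut /eqP tx; split=> //.
by rewrite inE xX -tx cardsE (card_uniqP ut) st eqxx.
Qed.

Lemma cochainE n f x t : is_cochain n f -> ordered_face X n x t ->
  f x t = orient f x *~ ord_sign t.
Proof.
move=> cf /ordered_faceP[xX st ut tx].
have oe := ordered_face_enum xX.
have se : size (enum x) == n by move: xX; rewrite -cardE inE => /andP[].
have st' : size t == n by rewrite st.
pose e := Tuple se; pose t' := Tuple st'.
have /tuple_permP[s tE] : perm_eq t' e.
  apply: uniq_perm => //=; first exact: enum_uniq.
  by move=> u; rewrite mem_enum -tx inE.
have := cf x e s oe; rewrite -[t]/(tval t') tE => ->.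
rewrite -[in RHS]tE.
have -> : ord_sign t' = (-1) ^+ s * ord_sign e.
  by rewrite -ord_sign_perm; congr ord_sign.
rewrite /orient -mulrzA [ord_sign (enum x) * _]mulrCA.
by rewrite ord_sign_sq ?enum_uniq // mulr1.
Qed.

Lemma cochain_of_orient n f (phi : forall x, F x) :
  (forall x t, ordered_face X n x t -> f x t = phi x *~ ord_sign t) ->
  is_cochain n f.
Proof.
move=> fE x t s ot.
have := ordered_faceP ot => -[xX _ ut tx].
rewrite !fE // ?ord_sign_perm 1?mulrC ?mulrzA //.
move: xX; rewrite inE => /andP[xX /eqP cx].
have pe : perm_eq [tuple tnth t (s i) | i < n] t by apply/tuple_permP; exists s.
rewrite /ordered_face xX size_tuple eqxx (perm_uniq pe) ut -tx /=.
by apply/eqP/setP=> u; rewrite !inE (perm_mem pe).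
Qed.

Lemma cobdE n f y t : is_cochain n f -> ordered_face X n.+1 y t ->
  cobd f y t = face_cobd (orient f) y *~ ord_sign t.
Proof.
move=> cf ot; have := ordered_faceP ot => -[yX st ut ty].
rewrite /face_cobd mulrz_suml.
rewrite (eq_bigl (mem t)) => [|u]; last by rewrite -ty inE.
rewrite -big_uniq //= big_tnth /cobd; apply: eq_bigr => i _.
set u := tnth _ i.
have it : (i < size t)%N by [].
have tE : t = take i t ++ u :: drop i.+1 t.
  by rewrite /u (tnth_nth u) -drop_nth // cat_take_drop.
have ud : uniq (take i t ++ u :: drop i.+1 t) by rewrite -tE.
have od : ordered_face X n (y :\ u) (del t i).
  rewrite /ordered_face; apply/and4P; split.
  - by apply: subX (subsetDl _ _); move: yX; rewrite inE => /andP[].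
  - rewrite /del size_cat size_take it size_drop -eqSS; lia.
  - by move: ud; rewrite /del uniq_catC cat_cons /= => /andP[_]; rewrite uniq_catC.
  apply/eqP/setP=> a; rewrite inE in_setD1 -ty inE [in RHS]tE /del !mem_cat inE.
  move: ud; rewrite uniq_catC cat_cons /= mem_cat negb_or => /andP[/andP[u1 u2] _].
  case: eqVneq => [->|_] /=; last by [].
  by rewrite (negPf u1) (negPf u2).
rewrite (cochainE cf od) raddfMz -!mulrzA; congr (_ *~ _).
rewrite mulrC /del; have := ord_sign_del ud; rewrite size_take it -tE => ->.
rewrite mulrC; congr (_ * _); rewrite /del_sign big_uniq /=; last first.
  by move: od => /ordered_faceP[].
apply: eq_bigl => a; move: od => /ordered_faceP[_ _ _ <-]; by rewrite inE.
Qed.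

End Orientation.

(** * Restricting cochains to links and extending them from links *)

Section LinkCochains.
Variables (V : finType) (X : {set {set V}}) (F : aug_sheaf X).
Hypothesis subX : forall x y : {set V}, y \in X -> x \subset y -> x \in X.
Implicit Types (f : cochain F) (x y z : {set V}) (t v : seq V).

(** The part of [f] on [D], read in the link of [z]; [v] is appended on the right to agree with
    [is_extension]. *)
Definition restrict f z v (D : pred {set V}) : cochain (link_sheaf F z) :=
  fun x t => if D (x :|: z) then f (x :|: z) (t ++ v) else 0.

Definition mask (D : pred {set V}) (phi : forall x, F x) x : F x :=
  if D x then phi x else 0.

Lemma sub_link z x y : y \in link X z -> x \subset y -> x \in link X z.
Proof.
rewrite !in_link => /andP[/eqP yz yX] xy; apply/andP; split.
  by rewrite -subset0 -yz setSI.
by apply: subX yX _; rewrite setSU.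
Qed.

Lemma ordered_face_cat n m z v x t : ordered_face X m z v ->
  ordered_face (link X z) n x t -> ordered_face X (n + m) (x :|: z) (t ++ v).
Proof.
move=> /ordered_faceP[_ sv uv vz] /ordered_faceP[].
rewrite inE in_link => /andP[/andP[/eqP xz xX] _] st ut tx.
rewrite /ordered_face xX size_cat st sv eqxx cat_uniq ut uv andbT /=.
apply/andP; split.
  apply/hasPn => u uv'; apply/negP => ut'.
  have : u \in x :&: z by rewrite inE -tx -vz !inE ut' uv'.
  by rewrite xz inE.
by apply/eqP/setP=> u; rewrite !inE mem_cat -tx -vz !inE.
Qed.

Lemma cross_signE t v x z : uniq t -> uniq v -> [set u in t] = x ->
  [set u in v] = z ->
  \prod_(u <- t) \prod_(a <- v) pair_sign u a = cross_sign x z.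
Proof.
move=> ut uv <- <-; rewrite /cross_sign big_uniq //=.
apply: eq_big => [u|u _]; first by rewrite inE.
by rewrite big_uniq //=; apply: eq_bigl => a; rewrite inE.
Qed.

Lemma cross_sign_sq x z : x :&: z = set0 -> cross_sign x z * cross_sign x z = 1.
Proof.
move=> xz; apply: prod_sq1 => u ux; apply: prod_sq1 => a az.
apply: pair_sign_sq; apply/eqP => ua.
have : u \in x :&: z by rewrite inE ux ua az.
by rewrite xz inE.
Qed.

Lemma restrictE n m z v f D x t : ordered_face X m z v -> is_cochain (n + m) f ->
  ordered_face (link X z) n x t ->
  restrict f z v D x t =
    mask D (orient f) (x :|: z) *~ (cross_sign x z * ord_sign v) *~ ord_sign t.
Proof.
move=> ov cf ot; rewrite /restrict /mask; case: ifP => _; last by rewrite !mul0rz.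
rewrite (cochainE cf (ordered_face_cat ov ot)) -mulrzA; congr (_ *~ _).
move: ov ot => /ordered_faceP[_ _ uv vz] /ordered_faceP[_ _ ut tx].
rewrite ord_sign_cat (cross_signE ut uv tx vz); ring.
Qed.

Lemma restrict_cochain n m z v f D : ordered_face X m z v -> is_cochain (n + m) f ->
  is_cochain n (restrict f z v D).
Proof.
move=> ov cf; apply: (@cochain_of_orient _ _ (link_sheaf F z) _ _
  (fun x => mask D (orient f) (x :|: z) *~ (cross_sign x z * ord_sign v))).
by move=> x t ot; exact: (restrictE D ov cf ot).
Qed.

Lemma orient_unique (Y : {set {set V}}) (G : aug_sheaf Y) n (f : cochain G)
    (phi : forall x, G x) x :
  (forall t, ordered_face Y n x t -> f x t = phi x *~ ord_sign t) ->
  x \in faces Y n -> orient f x = phi x.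
Proof.
move=> fE xY; rewrite /orient fE ?ordered_face_enum // -mulrzA.
by rewrite ord_sign_sq ?enum_uniq // mulr1z.
Qed.

Lemma face_cobd_ext (Y : {set {set V}}) (G : aug_sheaf Y)
    (phi psi : forall x, G x) y :
  (forall u, u \in y -> phi (y :\ u) = psi (y :\ u)) ->
  face_cobd phi y = face_cobd psi y.
Proof. by move=> h; apply: eq_bigr => u uy; rewrite h. Qed.

Lemma res_congr (phi : forall x, F x) a b y :
  a = b -> res F a y (phi a) = res F b y (phi b).
Proof. by move=> ->. Qed.

Lemma in_link_disj z x : x \in link X z -> x :&: z = set0.
Proof. by rewrite in_link => /andP[/eqP]. Qed.

Lemma facesD1 (Y : {set {set V}}) n y u :
  (forall x y, y \in Y -> x \subset y -> x \in Y) ->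
  y \in faces Y n.+1 -> u \in y -> y :\ u \in faces Y n.
Proof.
move=> subY; rewrite !inE => /andP[yY cy] uy.
rewrite (subY _ _ yY (subsetDl _ _)) /=.
by move: cy; rewrite (cardsD1 u) uy add1n eqSS.
Qed.

(** Deleting a vertex of [z] leaves a face where [phi] vanishes, so only vertices of [x] contribute;
    their signs against [z] are absorbed by [cross_sign]. *)
Lemma face_cobd_link z v (phi : forall x, F x) x :
  uniq v -> (forall y, ~~ (z \subset y) -> phi y = 0) -> x :&: z = set0 ->
  @face_cobd V (link X z) (link_sheaf F z)
     (fun x => phi (x :|: z) *~ (cross_sign x z * ord_sign v)) x =
  face_cobd phi (x :|: z) *~ (cross_sign x z * ord_sign v).
Proof.
move=> uv phi0 xz; rewrite /face_cobd [RHS]mulrz_suml /=.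
rewrite [RHS](bigID (mem z)) /= [X in X + _]big1 ?add0r; last first.
  move=> u /andP[_ uz]; rewrite phi0 ?raddf0 ?mul0rz //.
  by apply/negP => /subsetP/(_ u uz); rewrite !inE eqxx.
have disj u : u \in x -> u \notin z.
  by move=> ux; apply/negP => uz; have := in_set0 u; rewrite -xz inE ux uz.
apply: eq_big => [u|u ux].
  by rewrite inE; have := disj u; case: (u \in x) => [->|]; rewrite /= ?andbN.
have uz := disj u ux.
have E : (x :\ u) :|: z = (x :|: z) :\ u.
  apply/setP=> a; rewrite !inE; case: eqVneq => [->|] //=.
  by rewrite (negPf uz).
rewrite raddfMz (res_congr phi _ E) -!mulrzA; congr (_ *~ _).
have -> : del_sign u (x :|: z) = del_sign u x * \prod_(a in z) pair_sign u a.
  rewrite /del_sign -E big_mkcond (bigID (mem z)) /= mulrC; congr (_ * _).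
    rewrite -big_mkcondr /=; apply: eq_bigl => a; rewrite inE.
    case: (boolP (a \in z)) => az /=; last by rewrite orbF.
    apply/esym/negbTE; rewrite !inE negb_and; apply/orP; right.
    by apply/negP => /disj; rewrite az.
  by apply: eq_bigr => a az; rewrite inE az orbT.
have -> : cross_sign x z = (\prod_(a in z) pair_sign u a) * cross_sign (x :\ u) z.
  rewrite /cross_sign (bigD1 u) //=; congr (_ * _).
  by apply: eq_bigl => a; rewrite !inE andbC.
have sq : (\prod_(a in z) pair_sign u a) * (\prod_(a in z) pair_sign u a) = 1.
  apply: prod_sq1 => a az; apply: pair_sign_sq.
  by apply/negP => /eqP ua; rewrite ua az in uz.
set p := \prod_(a in z) _ in sq *.
transitivity (cross_sign (x :\ u) z * ord_sign v * del_sign u x * (p * p)).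
  by rewrite sq mulr1.
ring.
Qed.

Lemma cobd_restrict n m z v f (D : pred {set V}) x t : ordered_face X m z v ->
  is_cochain (n + m) f -> (forall y, D y -> z \subset y) ->
  ordered_face (link X z) n.+1 x t ->
  cobd (restrict f z v D) x t =
    face_cobd (mask D (orient f)) (x :|: z)
      *~ (cross_sign x z * ord_sign v) *~ ord_sign t.
Proof.
move=> ov cf Dz ot.
rewrite (cobdE (@sub_link z) (restrict_cochain D ov cf) ot); congr (_ *~ _).
have := ordered_faceP ot => -[xX _ _ _].
have xl : x \in link X z by move: xX; rewrite inE => /andP[].
have := ordered_faceP ov => -[_ _ uv _].
rewrite -face_cobd_link ?in_link_disj //; last first.
  by move=> y zy; rewrite /mask; case: ifP => // /Dz; rewrite (negPf zy).
apply: face_cobd_ext => u ux.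
apply: (@orient_unique _ (link_sheaf F z) n _
  (fun x => mask D (orient f) (x :|: z) *~ (cross_sign x z * ord_sign v))).
  by move=> t' ot'; exact: (restrictE D ov cf ot').
exact: (facesD1 (@sub_link z)).
Qed.

Lemma extension_exists n m z v (g : cochain (link_sheaf F z)) :
  ordered_face X m z v -> is_cochain n g ->
  exists h : cochain F, is_extension (n + m) v g h.
Proof.
move=> ov cg; have := ordered_faceP ov => -[zX sv uv vz].
pose G x : F (x :|: z) := orient g x *~ (cross_sign x z * ord_sign v).
(* The value lies in [F ((y :\: z) :|: z)] and is cast to [F y] along [e]. The equality fails
   exactly when [z] is not inside [y], where 0 is wanted. *)
pose psi y : F y := if (y :\: z) :|: z =P y is ReflectT e
  then eq_rect _ (fun s => F s) (G (y :\: z)) y e else 0.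
have psi1 x : x :&: z = set0 -> psi (x :|: z) = G x.
  move=> xz; rewrite /psi; have E := setUDK xz.
  case: eqP => [|[]]; last by rewrite E.
  by rewrite E => e; rewrite (eq_axiomK e).
have psi0 y : ~~ (z \subset y) -> psi y = 0.
  move=> zy; rewrite /psi; case: eqP => // e.
  by case/negP: zy; rewrite -e subsetUr.
exists (fun y t => psi y *~ ord_sign t); split.
- by apply: (@cochain_of_orient _ _ _ _ _ psi).
- rewrite sv addnK => x t ot; have := ordered_faceP ot => -[xX _ ut tx].
  have xz : x :&: z = set0 by apply: in_link_disj; move: xX; rewrite inE => /andP[].
  rewrite psi1 // (cochainE cg ot) /G -mulrzA; congr (_ *~ _).
  rewrite ord_sign_cat (cross_signE ut uv tx vz).
  transitivity (ord_sign t * (cross_sign x z * cross_sign x z)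
     * (ord_sign v * ord_sign v)); first by ring.
  by rewrite cross_sign_sq // ord_sign_sq // !mulr1.
by move=> y t _ zy; rewrite psi0 // mul0rz.
Qed.

End LinkCochains.

(** * Local minimality and expansion in links *)

Section LocalMinimality.
Variables (R : realType) (V : finType) (X : {set {set V}}) (F : aug_sheaf X).
Variable d : nat.
Hypothesis hX : is_dcomplex d X.
Implicit Types (f : cochain F) (x y z : {set V}) (t v : seq V).

Local Notation w := (weight R d X).
Local Notation subX := (subset_in_complex hX).

(** Values at equal faces may have different types, but their vanishing can be compared; norms need
    no more. *)
Lemma eq0_congr (phi : forall x, F x) a b : a = b -> (phi a == 0) = (phi b == 0).
Proof. by move=> ->. Qed.

Lemma cochain_eq0 n f x t : is_cochain n f -> ordered_face X n x t ->
  (f x t == 0) = (orient f x == 0).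
Proof.
move=> cf ot; rewrite (cochainE cf ot) mulrz_sq1_eq0 //.
by apply: ord_sign_sq; case/ordered_faceP: ot.
Qed.

Lemma cobd_eq0 n f x t : is_cochain n f -> ordered_face X n.+1 x t ->
  (cobd f x t == 0) = (face_cobd (orient f) x == 0).
Proof.
move=> cf ot; rewrite (cobdE subX cf ot) mulrz_sq1_eq0 //.
by apply: ord_sign_sq; case/ordered_faceP: ot.
Qed.

Lemma link_sign_sq z v x t n m : ordered_face X m z v ->
  ordered_face (link X z) n x t ->
  (cross_sign x z * ord_sign v * ord_sign t) ^+ 2 = 1.
Proof.
move=> /ordered_faceP[_ _ uv _] /ordered_faceP[xX _ ut _].
have xz : x :&: z = set0.
  by apply: (@in_link_disj _ X); move: xX; rewrite inE => /andP[].
by rewrite !exprMn !expr2 cross_sign_sq // !ord_sign_sq.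
Qed.

Lemma faces_setD n m z v y : ordered_face X m z v -> y \in faces X (n + m) ->
  z \subset y -> ordered_face (link X z) n (y :\: z) (enum (y :\: z)).
Proof.
move=> /ordered_faceP[zX _ _ _]; rewrite !inE => /andP[yX /eqP cy] zy.
have cz : #|z| = m by move: zX; rewrite inE => /andP[_ /eqP].
apply: ordered_face_enum; rewrite inE in_link setDUK // yX andbT.
rewrite cardsDS // cy cz addnK eqxx andbT.
by rewrite setDE -setIA [~: z :&: z]setIC setICr setI0.
Qed.

Lemma restrict_eq0 n m z v f D y : ordered_face X m z v -> is_cochain (n + m) f ->
  y \in faces X (n + m) -> z \subset y ->
  (restrict f z v D (y :\: z) (enum (y :\: z)) == 0) = (mask D (orient f) y == 0).
Proof.
move=> ov cf yX zy; have ot := faces_setD ov yX zy.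
rewrite (restrictE D ov cf ot) -mulrzA.
rewrite mulrz_sq1_eq0 -?expr2 ?(link_sign_sq ov ot) //.
exact/eq0_congr/setDUK.
Qed.

Lemma cobd_restrict_eq0 n m z v f (D : pred {set V}) y : ordered_face X m z v ->
  is_cochain (n + m) f -> (forall y, D y -> z \subset y) ->
  y \in faces X (n.+1 + m) -> z \subset y ->
  (cobd (restrict f z v D) (y :\: z) (enum (y :\: z)) == 0) =
  (face_cobd (mask D (orient f)) y == 0).
Proof.
move=> ov cf Dz yX zy; have ot := faces_setD ov yX zy.
rewrite (cobd_restrict subX ov cf Dz ot) -mulrzA.
rewrite mulrz_sq1_eq0 -?expr2 ?(link_sign_sq ov ot) //.
exact/eq0_congr/setDUK.
Qed.

(* Passing to part of the support preserves minimality: the discarded part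
   costs at most its own norm on both sides. *)
Lemma restrict_minimal n m z v f (D : pred {set V}) (b : cochain (link_sheaf F z)) :
  ordered_face X m z v -> (0 < m <= d)%N -> is_cochain (n + m) f ->
  locally_minimal R d (n + m) f -> (forall y, D y -> z \subset y) ->
  is_coboundary n b ->
  norm R (d - #|z|) n (restrict f z v D)
    <= norm R (d - #|z|) n (addc (restrict f z v D) b).
Proof.
move=> ov /andP[m0 md] cf lm Dz.
have := ordered_faceP ov => -[zfX sv uv vz].
have [zX cz] : z \in X /\ #|z| = m by move: zfX; rewrite inE => /andP[? /eqP].
case: n cf lm => [|n] cf lm cb.
  rewrite le_eqVlt; apply/orP; left; apply/eqP; apply: eq_bigl => x.
  apply: andb_id2l => xX; rewrite /addc cb ?addr0 //; exact: ordered_face_enum.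
case: cb => g cg bE.
have [h eh] := extension_exists ov cg; have [ch hE h0] := eh.
have mn : (0 < m < n.+1 + m)%N by rewrite m0 /= addSn ltnS leq_addl.
have := lm m z v mn ov g; rewrite addSn /= addnK => /(_ cg h eh) lmin.
have oh0 y : y \in faces X (n + m) -> ~~ (z \subset y) -> orient h y = 0.
  by move=> yX zy; rewrite /orient h0 ?mul0rz // ordered_face_enum.
pose Dz' := [pred y : {set V} | z \subset y].
have maskh y : y \in faces X (n.+1 + m) ->
    face_cobd (mask Dz' (orient h)) y = face_cobd (orient h) y.
  move=> yX; apply: face_cobd_ext => u uy; rewrite /mask /=.
  by case: ifPn => // zy; rewrite oh0 // (facesD1 subX).
have bh y : y \in faces X (n.+1 + m) -> z \subset y ->
    addc (restrict f z v D) b (y :\: z) (enum (y :\: z)) =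
    (mask D (orient f) ((y :\: z) :|: z) + face_cobd (orient h) ((y :\: z) :|: z))
      *~ (cross_sign (y :\: z) z * ord_sign v * ord_sign (enum (y :\: z))).
  move=> yX zy; have ot := faces_setD ov yX zy.
  rewrite /addc (restrictE D ov cf ot) bE // mulrzDl -!mulrzA; congr (_ + _).
  have gE : cobd g (y :\: z) (enum (y :\: z)) =
            cobd (restrict h z v Dz') (y :\: z) (enum (y :\: z)).
    rewrite (cobdE (@sub_link _ _ subX z) cg ot).
    rewrite (cobdE (@sub_link _ _ subX z) (restrict_cochain Dz' ov ch) ot).
    congr (_ *~ _); apply: face_cobd_ext => u uy.
    rewrite /orient; congr (_ *~ _).
    rewrite /restrict /= subsetUr; apply/esym; apply: hE.
    rewrite sv addnK; apply: ordered_face_enum.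
    by apply: facesD1 uy; [exact: (@sub_link _ _ subX z) | case/ordered_faceP: ot].
  rewrite gE (cobd_restrict subX ov ch (D := Dz')) // -mulrzA; congr (_ *~ _).
  by apply: maskh; rewrite setDUK.
have zd : (#|z| <= d)%N by rewrite cz.
have cW : 0 < ('C(n.+1 + m, m)%:R * w z)^-1.
  by rewrite invr_gt0 mulr_gt0 ?weight_gt0 // ltr0n bin_gt0 leq_addl.
rewrite /norm !sum_link_weight // cz ler_pM2l //.
have N1 : norm R d (n.+1 + m) f = \sum_(y in faces X (n.+1 + m))
    (if orient f y != 0 then w y else 0).
  rewrite /norm big_mkcondr; apply: eq_bigr => y yX.
  by rewrite (cochain_eq0 cf) // ordered_face_enum.
have N2 : norm R d (n.+1 + m) (addc f (cobd h)) = \sum_(y in faces X (n.+1 + m))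
    (if orient f y + face_cobd (orient h) y != 0 then w y else 0).
  rewrite /norm big_mkcondr; apply: eq_bigr => y yX; rewrite /addc.
  have oy := ordered_face_enum yX.
  rewrite (cochainE cf oy) (cobdE subX ch oy) -mulrzDl mulrz_sq1_eq0 //.
  by rewrite ord_sign_sq ?enum_uniq.
move: lmin; rewrite -addSn N1 N2 => lmin.
set m1 := n.+1 + m in lmin *.
(* With local minimality of [f] this gives the claim, and it holds face by face: on [D] the two
   sides agree, on other faces through [z] it says that a nonzero sum has a nonzero summand, and
   elsewhere the coboundary of [h] vanishes. *)
suff : \sum_(y in faces X m1)
      (if orient f y + face_cobd (orient h) y != 0 then w y else 0)
    + \sum_(y in faces X m1 | (z \subset y) &&
        (restrict f z v D (y :\: z) (enum (y :\: z)) != 0)) w y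
  <= \sum_(y in faces X m1) (if orient f y != 0 then w y else 0)
    + \sum_(y in faces X m1 | (z \subset y) &&
        (addc (restrict f z v D) b (y :\: z) (enum (y :\: z)) != 0)) w y.
  by move: lmin; set A := bigop.body _ _ _; set B := bigop.body _ _ _; lra.
rewrite [X in _ + X <= _]big_mkcondr [X in _ <= _ + X]big_mkcondr -!big_split /=.
apply: ler_sum => y yX; have wy : 0 <= w y by exact: weight_ge0.
have [zy|zy] /= := boolP (z \subset y); last first.
  rewrite (_ : face_cobd (orient h) y = 0) ?addr0 //.
  apply: big1 => u uy; rewrite oh0 ?raddf0 ?mul0rz ?(facesD1 subX) //.
  by apply: contra zy => zy; apply: subset_trans zy (subsetDl _ _).
rewrite (restrict_eq0 D ov cf yX zy) bh //.
rewrite [_ *~ (cross_sign _ _ * _ * _) == 0]mulrz_sq1_eq0; last first.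
  by rewrite -[RHS](link_sign_sq ov (faces_setD ov yX zy)) expr2.
rewrite (eq0_congr (fun y => mask D (orient f) y + face_cobd (orient h) y) (setDUK zy)).
rewrite /mask; case: (D y); first by rewrite addrC.
rewrite add0r eqxx /= addr0.
have [->|_] := eqVneq (orient f y) 0; first by rewrite !add0r.
by case: ifP => _ /=; case: ifP => _; rewrite ?addr0 ?lerDl ?addr_ge0.
Qed.

Lemma local_expansion n m z v f (D : pred {set V}) (e : R) :
  ordered_face X m z v -> (0 < m <= d)%N -> (n + m <= d)%N ->
  is_cochain (n + m) f ->
  locally_minimal R d (n + m) f -> (forall y, D y -> z \subset y) ->
  (forall y, y \in faces X (n.+1 + m) -> nontrivial (F y)) -> 0 <= e ->
  cobd_expander (link_sheaf F z) (d - #|z|) n e ->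
  e * 'C(n.+1 + m, m)%:R * (\sum_(y in faces X (n + m) | D y && (orient f y != 0)) w y)
  <= 'C(n + m, m)%:R *
     \sum_(y in faces X (n.+1 + m) |
       (z \subset y) && (face_cobd (mask D (orient f)) y != 0)) w y.
Proof.
move=> ov md nd cf lm Dz nt e0 /(_ _ (restrict_cochain D ov cf))[b [cb _ hb]].
have := ordered_faceP ov => -[zfX sv uv vz].
have [zX cz] : z \in X /\ #|z| = m by move: zfX; rewrite inE => /andP[? /eqP].
have zd : (#|z| <= d)%N by rewrite cz; case/andP: md.
have wz : 0 < w z by exact: weight_gt0.
have m1 : mass R (link_sheaf F z) (d - #|z|) n.+1 = 1.
  rewrite -[RHS](@sum_link_weight1 R V X d hX z n.+1) // ?cz //.
  apply: eq_bigl => x; apply: andb_idr => xX; apply/asboolP.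
  apply: nt; move: xX; rewrite !inE in_link => /andP[/andP[/eqP xz ->] /eqP cx].
  by rewrite card_setU_disj // cx cz eqxx.
have m2 : mass R (link_sheaf F z) (d - #|z|) n <= 1.
  rewrite -[X in _ <= X](@sum_link_weight1 R V X d hX z n) // ?cz ?leqW //.
  rewrite /mass big_mkcondr; apply: ler_sum => x _.
  by case: ifP => // _; exact: weight_ge0.
have norm0 (n' : nat) (g : cochain (link_sheaf F z)) : 0 <= norm R (d - #|z|) n' g.
  by apply: sumr_ge0 => x _; exact: weight_ge0.
have : e * norm R (d - #|z|) n (restrict f z v D)
    <= norm R (d - #|z|) n.+1 (cobd (restrict f z v D)).
  apply: (@le_trans _ _ (e * norm R (d - #|z|) n (addc (restrict f z v D) b))).
    by apply: ler_wpM2l => //; exact: (restrict_minimal ov md cf lm Dz cb).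
  rewrite m1 mulr1 in hb; apply: (le_trans hb).
  by rewrite ler_piMr ?norm0.
rewrite /norm !sum_link_weight // cz.
have -> : \sum_(y in faces X (n + m) | (z \subset y) &&
      (restrict f z v D (y :\: z) (enum (y :\: z)) != 0)) w y =
    \sum_(y in faces X (n + m) | D y && (orient f y != 0)) w y.
  apply: eq_bigl => y; apply: andb_id2l => yX.
  have [zy|zy] := boolP (z \subset y).
    by rewrite (restrict_eq0 D ov cf yX zy) /mask; case: ifP => //=; rewrite eqxx.
  by case: (boolP (D y)) => // /Dz; rewrite (negPf zy).
have -> : \sum_(y in faces X (n.+1 + m) | (z \subset y) &&
      (cobd (restrict f z v D) (y :\: z) (enum (y :\: z)) != 0)) w y =
    \sum_(y in faces X (n.+1 + m) |
       (z \subset y) && (face_cobd (mask D (orient f)) y != 0)) w y.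
  apply: eq_bigl => y; apply: andb_id2l => yX; apply: andb_id2l => zy.
  by rewrite (cobd_restrict_eq0 ov cf Dz yX zy).
set A := bigop.body _ _ _; set B := bigop.body _ _ _.
have c1 : 0 < 'C(n + m, m)%:R :> R by rewrite ltr0n bin_gt0 leq_addl.
have c2 : 0 < 'C(n.+1 + m, m)%:R :> R by rewrite ltr0n bin_gt0 leq_addl.
move: (w z) wz c1 c2 => W; set a := 'C(_, _)%:R; set c := 'C(_, _)%:R.
move=> W0 a0 c0 h.
have acW : 0 < a * c * W by rewrite !mulr_gt0.
have -> : e * c * A = (e * ((a * W)^-1 * A)) * (a * c * W).
  by field; rewrite !gt_eqF.
have -> : a * B = ((c * W)^-1 * B) * (a * c * W).
  by field; rewrite !gt_eqF.
by rewrite ler_pM2r.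
Qed.

End LocalMinimality.

(** * Descent through fat faces *)

Section Descent.
Variables (V : finType) (T : {set {set V}}).
Implicit Types (x y z u : {set V}).

Definition descent : rel {set V} := fun a b =>
  [&& a \in T, b \in T & [exists v in a, b == a :\ v]].

Definition terminal z := (z \in T) && [forall v in z, z :\ v \notin T].

Definition good y : Prop := forall u v v', v \notin u -> v' \notin u -> v != v' ->
  v |: (v' |: u) \subset y -> v |: u \in T -> v' |: u \in T -> u \in T.

Lemma descent_sub x z : connect descent x z -> z \subset x.
Proof.
case/connectP=> p; elim: p x => [|a p IH] x /=; first by move=> _ ->.
case/andP=> /and3P[_ _ /existsP[v /andP[_ /eqP aE]]] pa zE.
by apply: subset_trans (IH a pa zE) _; rewrite aE subsetDl.
Qed.

Lemma descent1 x v : x \in T -> v \in x -> x :\ v \in T -> connect descent x (x :\ v).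
Proof.
move=> xT vx xvT; apply: connect1; rewrite /descent xT xvT.
by apply/existsP; exists v; rewrite vx eqxx.
Qed.

Lemma descentU1 u v : v \notin u -> u \in T -> v |: u \in T ->
  connect descent (v |: u) u.
Proof.
move=> vu uT vuT; rewrite -[X in connect _ _ X](setU1K vu).
by apply: descent1; rewrite ?setU11 ?setU1K.
Qed.

Lemma terminal_exists x : x \in T -> exists2 z, terminal z & connect descent x z.
Proof.
have [n] := ubnP #|x|; elim: n x => // n IH x cx xT.
have [tx|] := boolP (terminal x); first by exists x.
rewrite /terminal xT /= negb_forall => /existsP[v].
rewrite negb_imply negbK => /andP[vx xvT].
have [|z tz cz] := IH (x :\ v) _ xvT.
  by move: cx; rewrite (cardsD1 v) vx.
by exists z => //; apply: connect_trans cz; exact: descent1.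
Qed.

Lemma terminal_connect z z' : terminal z -> connect descent z z' -> z' = z.
Proof.
move=> /andP[_ /forallP tz] /connectP[[|a p] /= ]; first by move=> _ ->.
case/andP=> /and3P[_ aT /existsP[v /andP[vz /eqP aE]]] _ _.
by have := tz v; rewrite vz /= -aE aT.
Qed.

Lemma connect_descent_head x z : connect descent x z ->
  x = z \/ exists v, [/\ v \in x, x :\ v \in T & connect descent (x :\ v) z].
Proof.
case/connectP=> [[|a p]] /=; first by move=> _ ->; left.
case/andP=> /and3P[_ aT /existsP[v /andP[vx /eqP aE]]] pa ->; right.
by exists v; rewrite -aE; split=> //; apply/connectP; exists p.
Qed.

(* A diamond argument: in a good face two descents can be joined. *)
Lemma terminal_unique y x z z' : good y -> x \in T -> x \subset y ->
  terminal z -> terminal z' ->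
  connect descent x z -> connect descent x z' -> z = z'.
Proof.
move=> gy; have [n] := ubnP #|x|; elim: n x z z' => // n IH x z z' cx xT xy tz tz'.
move=> xz xz'.
case: (connect_descent_head xz) => [xE|[v [vx xvT vz]]].
  by rewrite xE in xz'; rewrite (terminal_connect tz xz').
case: (connect_descent_head xz') => [xE|[v' [v'x xv'T v'z']]].
  by rewrite xE in xz; rewrite (terminal_connect tz' xz).
have sub a : x :\ a \subset y by apply: subset_trans (subsetDl _ _) xy.
have lt a : a \in x -> (#|x :\ a| < n)%N.
  by move=> ax; move: cx; rewrite (cardsD1 a) ax.
have [vv'|vv'] := eqVneq v v'.
  by rewrite -vv' in v'z'; apply: (IH (x :\ v)); rewrite ?lt.
pose u := x :\ v :\ v'.
have uv : v \notin u by rewrite !inE eqxx andbF.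
have uv' : v' \notin u by rewrite !inE eqxx.
have uE : v' |: u = x :\ v by rewrite setD1K // !inE eq_sym vv'.
have uE' : v |: u = x :\ v'.
  apply/setP=> a; rewrite !inE; have [->|av] := eqVneq a v; last by [].
  by rewrite vv' vx.
have uT : u \in T.
  by apply: (gy u v v'); rewrite ?uE ?uE' // setD1K.
have [t tt ut] := terminal_exists uT.
have vt : connect descent (x :\ v) t.
  by apply: connect_trans ut; rewrite -uE; apply: descentU1; rewrite ?uE.
have v't : connect descent (x :\ v') t.
  by apply: connect_trans ut; rewrite -uE'; apply: descentU1; rewrite ?uE'.
rewrite (IH (x :\ v) z t) ?lt //; apply: (IH (x :\ v')); rewrite ?lt //.
Qed.

(** The two facets meet in [y :\ a :\ b], which is in [T] as [y] is good. Descending on from there,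
    uniqueness shows that the end is [z]. *)
Lemma facet_terminal y a b z : good y -> a \in y -> b \in y ->
  y :\ a \in T -> y :\ b \in T -> terminal z ->
  connect descent (y :\ a) z -> connect descent (y :\ b) z.
Proof.
move=> gy ay by_ aT bT tz az; have [<- //|ab] := eqVneq a b.
pose u := y :\ a :\ b.
have ua : a \notin u by rewrite !inE eqxx andbF.
have ub : b \notin u by rewrite !inE eqxx.
have uE : b |: u = y :\ a by rewrite setD1K // !inE eq_sym ab.
have uE' : a |: u = y :\ b.
  apply/setP=> v; rewrite !inE; have [->|av] := eqVneq v a; last by [].
  by rewrite ab ay.
have uT : u \in T by apply: (gy u a b); rewrite ?uE ?uE' // setD1K.
have [t tt ut] := terminal_exists uT.
have at_ : connect descent (y :\ a) t.
  by apply: connect_trans ut; rewrite -uE; apply: descentU1; rewrite ?uE.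
rewrite (terminal_unique gy aT (subsetDl _ _) tz tt az at_).
by apply: connect_trans ut; rewrite -uE'; apply: descentU1; rewrite ?uE'.
Qed.

End Descent.

(** * Comparing the coboundary of [f] with those of its parts *)

Section FatCount.
Variables (R : realType) (V : finType) (X : {set {set V}}) (F : aug_sheaf X).
Variables (d k : nat) (T : {set {set V}}) (f : cochain F).
Hypothesis hX : is_dcomplex d X.
Hypothesis suppT : forall x, x \in faces X k.+1 -> (x \in T) = (orient f x != 0).
Implicit Types (x y z : {set V}) (u : V).

Local Notation D z := [pred y | connect (descent T) y z].
Local Notation phi := (orient f).

Lemma mask_neq0 z y u : y \in faces X k.+2 -> u \in y ->
  mask (D z) phi (y :\ u) != 0 -> y :\ u \in T /\ connect (descent T) (y :\ u) z.
Proof.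
move=> yX uy; rewrite /mask /=; case: ifP => [c p0|]; last by rewrite eqxx.
by rewrite suppT // (facesD1 (subset_in_complex hX)).
Qed.

Lemma face_cobd_neq0 (psi : forall x, F x) y : face_cobd psi y != 0 ->
  exists2 u, u \in y & psi (y :\ u) != 0.
Proof.
move=> c0; have [/existsP[u /andP[uy h]]|] := boolP [exists u in y, psi (y :\ u) != 0].
  by exists u.
rewrite negb_exists => /forallP h; case/negP: c0; apply/eqP; apply: big1 => u uy.
by have := h u; rewrite uy negbK => /eqP ->; rewrite raddf0 mul0rz.
Qed.

(** If one facet of [y] in the support descends to [z], then all do, so the mask changes nothing at
    [y]. *)
Lemma face_cobd_good y z : y \in faces X k.+2 -> good T y -> terminal T z ->
  face_cobd (mask (D z) phi) y != 0 -> face_cobd phi y != 0.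
Proof.
move=> yX gy tz c0; have [u uy mu] := face_cobd_neq0 c0.
have [uT uz] := mask_neq0 yX uy mu.
rewrite (_ : face_cobd phi y = face_cobd (mask (D z) phi) y) //.
apply: face_cobd_ext => a ay; rewrite /mask /=; case: ifPn => // na.
apply/eqP; apply: contraNT na => pa.
have aT : y :\ a \in T by rewrite suppT // (facesD1 (subset_in_complex hX)).
exact: (facet_terminal gy uy ay uT aT tz uz).
Qed.

(** At most one [z] contributes at a good [y], and then the coboundary of [f] is nonzero there. At a
    bad [y] all its subsets are counted. *)
Lemma terminal_count y : y \in faces X k.+2 ->
  \sum_(z | terminal T z) ((z \subset y) && (face_cobd (mask (D z) phi) y != 0))%:R
  <= (face_cobd phi y != 0)%:R + (`[< ~ good T y >])%:R * 2 ^+ k.+2 :> R.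
Proof.
move=> yX; have [gy|bad] := pselect (good T y); last first.
  rewrite (asboolT bad) mul1r ler_wpDl //.
  have -> : 2 ^+ k.+2 = \sum_(z : {set V}) (z \subset y)%:R :> R.
    rewrite -natr_sum -natrX; congr (_%:R); move: yX; rewrite inE => /andP[_ /eqP <-].
    rewrite -card_powerset -sum1_card big_mkcond; apply: eq_bigr => z _.
    by rewrite powersetE; case: (z \subset y).
  rewrite big_mkcond; apply: ler_sum => z _; case: ifP => _ //.
  by case: (z \subset y); rewrite //= ?ler_nat ?leq_b1.
have -> : `[< ~ good T y >] = false by apply/negbTE/asboolPn; apply.
rewrite mul0r addr0.
have [/existsP[z0 /and3P[tz0 zy0 c0]]|] := boolP [exists z,
    [&& terminal T z, z \subset y & face_cobd (mask (D z) phi) y != 0]].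
  rewrite (face_cobd_good yX gy tz0 c0) (bigD1 z0) //= [X in _ + X]big1 ?addr0.
    by rewrite ler_nat leq_b1.
  move=> z /andP[tz zz0]; apply/eqP; rewrite pnatr_eq0 eqb0; apply/negP.
  case/andP=> zy c; case/negP: zz0; apply/eqP.
  have [u uy /(mask_neq0 yX uy)[uT uz]] := face_cobd_neq0 c.
  have [u0 u0y /(mask_neq0 yX u0y)[u0T u0z]] := face_cobd_neq0 c0.
  apply: (terminal_unique gy u0T (subsetDl _ _) tz tz0 _ u0z).
  exact: (facet_terminal gy uy u0y uT u0T tz uz).
rewrite negb_exists => /forallP h; rewrite big1 // => z tz.
by have := h z; rewrite tz /= => /negPf ->.
Qed.

End FatCount.

(** * Fat families and the weight of bad faces *)

Section FatFaces.
Variables (R : realType) (V : finType) (X : {set {set V}}) (d k : nat).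
Hypothesis hX : is_dcomplex d X.
Implicit Types (x y z u : {set V}) (v : V).

Local Notation w := (weight R d X).

Definition up_weight (T : {set {set V}}) u : R :=
  \sum_v vweight R X d u v * (v |: u \in T)%:R.

(** By [sum_vweight], [#|z|.+1%:R * w z] is the total vertex weight around [z], so [h] bounds a
    proportion. Grade [k.+1] is left free. *)
Definition fat_family (h : nat -> R) (T : {set {set V}}) : Prop :=
  {subset T <= [set z in X | (#|z| <= k.+1)%N]} /\
  forall z, z \in X -> (#|z| <= k)%N ->
    (z \in T) = (h #|z| * (#|z|.+1%:R * w z) <= up_weight T z).

Lemma fat_family_exists (h : nat -> R) (A : {set {set V}}) :
  A \subset faces X k.+1 ->
  exists2 T, fat_family h T & forall z, #|z| = k.+1 -> (z \in T) = (z \in A).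
Proof.
move=> AX.
pose next (T : {set {set V}}) n :=
  [set z in faces X n | h #|z| * (#|z|.+1%:R * w z) <= up_weight T z].
(* [L n] is the level of grade [k.+1 - n]; each level depends only on the one above it. *)
pose L := fix L n := if n is n'.+1 then next (L n') (k - n')%N else A.
have LX n z : (n <= k.+1)%N -> z \in L n -> z \in faces X (k.+1 - n)%N.
  case: n => [_|n nk]; first by rewrite subn0; move/(subsetP AX).
  by rewrite subSS inE => /andP[].
pose T := [set z : {set V} | (#|z| <= k.+1)%N && (z \in L (k.+1 - #|z|)%N)].
exists T; last by move=> z cz; rewrite inE cz leqnn subnn.
split.
  move=> z; rewrite !inE => /andP[cz] /LX; rewrite leq_subr inE => /(_ isT).
  by case/andP=> ->.
move=> z zX cz; rewrite inE leqW // subSn //= !inE zX subKn // eqxx /=.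
congr (_ <= _); apply: eq_bigr => v _; rewrite /vweight.
case: ifP => vz; last by rewrite !mul0r.
by rewrite inE cardsU1 vz add1n ltnS cz subSS.
Qed.

Section Counting.
Variables (h : nat -> R) (T : {set {set V}}).
Hypothesis fatT : fat_family h T.
Hypothesis kd : (k < d)%N.

Definition fat_weight j : R := \sum_(z in T | #|z| == j) w z.

Lemma up_weight_ge0 u : 0 <= up_weight T u.
Proof. by apply: sumr_ge0 => v _; rewrite mulr_ge0 // vweight_ge0. Qed.

Lemma sum_up_weight j :
  \sum_(u : {set V} | #|u| == j) up_weight T u = j.+1%:R * fat_weight j.+1.
Proof.
transitivity (\sum_(u : {set V}) \sum_(v | v \notin u)
   (if (#|u| == j) && (v |: u \in T) then w (v |: u) else 0)).
  rewrite big_mkcond; apply: eq_bigr => u _; rewrite [RHS]big_mkcond /up_weight.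
  case: eqP => _ /=; last by rewrite big1 // => v _; rewrite if_same.
  apply: eq_bigr => v _; rewrite /vweight; case: ifP => _; last by rewrite mul0r.
  by case: (_ \in T); rewrite ?mulr1 ?mulr0.
rewrite (@sum_setU1 V R (fun u v =>
  if (#|u| == j) && (v |: u \in T) then w (v |: u) else 0)).
rewrite /fat_weight mulr_sumr [RHS]big_mkcond; apply: eq_bigr => x _.
transitivity (\sum_(v in x) (if (#|x| == j.+1) && (x \in T) then w x else 0)).
  by apply: eq_bigr => v vx; rewrite setD1K // [in RHS](cardsD1 v) vx add1n eqSS.
rewrite sumr_const; case: (x \in T); rewrite ?andbF ?mul0rn //= andbT.
by case: eqP => [->|_]; rewrite ?mulr_natl ?mul0rn.
Qed.

(** Sum the fatness condition over grade [j]: a fat face of grade [j.+1] is met once for each of its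
    vertices. *)
Lemma fat_weight_step j : (j <= k)%N -> h j * fat_weight j <= fat_weight j.+1.
Proof.
move=> jk; have j0 : 0 < j.+1%:R :> R by rewrite ltr0n.
rewrite -(ler_pM2l j0) -sum_up_weight /fat_weight !mulr_sumr.
rewrite big_mkcond [X in _ <= X]big_mkcond; apply: ler_sum => z _ /=.
case: (boolP (z \in T)) => zT; case: eqP => //= cz; last first.
  exact: up_weight_ge0.
case: fatT => sT fT; have := sT z zT; rewrite inE => /andP[zX _].
by move: zT; rewrite fT ?cz // mulrCA.
Qed.

(** The edges between fat neighbours of [u] are measured by the quadratic form of an indicator
    function, to which the spectral bound applies. The binomial weighs the faces of grade [k.+2]
    over such an edge. *)
Lemma weight_bad_le (l : R) : (forall j, (j <= k)%N -> l <= h j) ->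
  (forall j, (j <= k)%N -> 0 <= h j) ->
  (forall u (g : V -> R), u \in X -> (#|u| < d)%N ->
     \sum_v \sum_v' eweight R X d u v v' * g v * g v' <=
     #|u|.+2%:R * (l * (\sum_v vweight R X d u v * g v ^+ 2)
      + (\sum_v vweight R X d u v * g v) ^+ 2 / (#|u|.+1%:R * w u))) ->
  \sum_(y in faces X k.+2 | `[< ~ good T y >]) w y <=
  \sum_(j < k.+1) 'C(k.+2, j.+2)%:R
    * (j.+2%:R * (2 * h j) * (j.+1%:R * fat_weight j.+1)).
Proof.
move=> lh h0 form; have [sT fT] := fatT.
pose I (u : {set V}) v : R := (v |: u \in T)%:R.
have I0 u v : 0 <= I u v by [].
have IX u v : I u v != 0 -> v \notin u -> u \in X /\ (#|u| <= k)%N.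
  rewrite /I pnatr_eq0 eqb0 negbK => /sT; rewrite inE => /andP[vX cv] vu.
  split; first exact: (subset_in_complex hX vX (subsetUr _ _)).
  by move: cv; rewrite cardsU1 vu.
pose Q (u : {set V}) : R := \sum_v \sum_v' eweight R X d u v v' * I u v * I u v'.
have term0 u v v' : 0 <= eweight R X d u v v' * I u v * I u v'.
  by rewrite !mulr_ge0 // eweight_ge0.
have Q0 u : 0 <= Q u by apply: sumr_ge0 => v _; apply: sumr_ge0 => v' _.
apply: (@le_trans _ _ (\sum_(u : {set V} | (u \notin T) && (#|u| <= k)%N)
                         'C(k.+2, #|u|.+2)%:R * Q u)).
  (* Union bound over witnesses of badness; counting ordered pairs only enlarges the sum. *)
  pose c (y u : {set V}) v v' := [&& v \notin u, v' \notin u, v != v',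
     v |: (v' |: u) \subset y, v |: u \in T & v' |: u \in T].
  apply: (@le_trans _ _ (\sum_(y in faces X k.+2)
     \sum_(u : {set V} | (u \notin T) && (#|u| <= k)%N)
       \sum_v \sum_v' (c y u v v')%:R * w y)).
    rewrite big_mkcondr; apply: ler_sum => y yX; have wy := weight_ge0 R X d y.
    have cw u v v' : 0 <= (c y u v v')%:R * w y by rewrite mulr_ge0.
    case: ifPn => [/asboolP bad|_]; last first.
      by apply: sumr_ge0 => u _; apply: sumr_ge0 => v _; apply: sumr_ge0.
    have [u [v [v' [uT cu]]]] : exists u v v', u \notin T /\ c y u v v'.
      apply: contrapT => nex; apply: bad => u v v' vu v'u vv' sub vT v'T.
      apply: contrapT => /negP uT; apply: nex; exists u, v, v'; split=> //.
      by rewrite /c vu v'u vv' sub vT v'T.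
    have uk : (#|u| <= k)%N.
      case/and5P: cu => vu _ _ _ /andP[vT _]; have := sT _ vT.
      by rewrite inE cardsU1 vu => /andP[].
    rewrite (bigD1 u) ?uT //= (bigD1 v) //= (bigD1 v') //= cu mul1r -!addrA lerDl.
    rewrite !addr_ge0 //.
    - exact: sumr_ge0.
    - by apply: sumr_ge0 => ? _; apply: sumr_ge0.
    - by apply: sumr_ge0 => ? _; apply: sumr_ge0 => ? _; apply: sumr_ge0.
  rewrite exchange_big /=; apply: ler_sum => u /andP[uT uk].
  rewrite exchange_big /= mulr_sumr; apply: ler_sum => v _.
  rewrite exchange_big /= mulr_sumr; apply: ler_sum => v' _.
  have [/and3P[vu v'u vv']|ncond] :=
    boolP [&& v \notin u, v' \notin u & v != v']; last first.
    rewrite big1 => [|y _]; first by rewrite mulr_ge0 // term0.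
    rewrite /c.
    case: (boolP [&& _, _, _, _, _ & _]) => [/and5P[h1 h2 h3 _ _]|_]; last first.
      by rewrite mul0r.
    by rewrite h1 h2 h3 in ncond.
  rewrite {1}/eweight vu v'u vv' /= /I.
  have cE : #|v |: (v' |: u)| = #|u|.+2.
    by rewrite !cardsU1 !inE negb_or vu v'u vv'.
  rewrite mulrA mulrA -cE -(sum_faces_weight_sup _ hX); last first.
    by rewrite cE !ltnS uk /=; lia.
  rewrite -mulrA mulr_suml big_mkcondr le_eqVlt; apply/orP; left; apply/eqP.
  apply: eq_bigr => y yX; rewrite /c vu v'u vv' /=.
  case: (_ \subset y) => /=; last by rewrite !mul0r.
  by case: (v |: u \in T); case: (v' |: u \in T); rewrite ?mulr1 ?mul1r ?mulr0 ?mul0r.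
apply: (@le_trans _ _ (\sum_(u : {set V} | (#|u| <= k)%N)
   'C(k.+2, #|u|.+2)%:R * (#|u|.+2%:R * (2 * h #|u|) * up_weight T u))).
  rewrite big_mkcondl; apply: ler_sum => u uk; have hu := h0 _ uk.
  have M0 := up_weight_ge0 u.
  have pos : 0 <= #|u|.+2%:R * (2 * h #|u|) * up_weight T u.
    by rewrite !mulr_ge0.
  case: ifP => uT; last by rewrite mulr_ge0.
  apply: ler_wpM2l => //.
  have [uX|uX] := boolP (u \in X); last first.
    apply: le_trans pos; rewrite /Q big1 // => v _; apply: big1 => v' _.
    rewrite /eweight; case: ifP => [/and3P[vu _ _]|_]; last by rewrite !mul0r.
    have [->|/IX/(_ vu)[uX' _]] := eqVneq (I u v) 0; first by rewrite mulr0 mul0r.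
    by rewrite uX' in uX.
  apply: (le_trans (form u (I u) uX (leq_ltn_trans uk kd))).
  have -> : \sum_v vweight R X d u v * I u v ^+ 2 = up_weight T u.
    by apply: eq_bigr => v _; rewrite /I; case: (_ \in T); rewrite ?expr1n ?expr0n.
  rewrite -[\sum_v _]/(up_weight T u) -mulrA; apply: ler_wpM2l => //.
  (* As [u] is not fat, the square of [up_weight] over the total weight is at most
     [h #|u| * up_weight T u]. The term in [l] obeys the same bound, hence the factor 2. *)
  have lt : up_weight T u < h #|u| * (#|u|.+1%:R * w u).
    by move: uT; rewrite fT // ltNge => ->.
  have Tw : 0 < #|u|.+1%:R * w u by rewrite mulr_gt0 ?weight_gt0.
  rewrite mulr2n mulrDl mul1r mulrDl; apply: lerD.
    by apply: ler_wpM2r => //; exact: lh.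
  rewrite expr2 -mulrA mulrC; apply: ler_wpM2r => //.
  by rewrite ler_pdivrMr // ltW.
rewrite le_eqVlt; apply/orP; left; apply/eqP.
transitivity (\sum_(j < k.+1) \sum_(u : {set V} | #|u| == j)
  'C(k.+2, #|u|.+2)%:R * (#|u|.+2%:R * (2 * h #|u|) * up_weight T u)).
  pose p (u : {set V}) : 'I_k.+1 := inord #|u|.
  rewrite (partition_big p xpredT) //=; apply: eq_bigr => j _; apply: eq_bigl => u.
  apply/andP/eqP => [[uk /eqP <-]|uj]; first by rewrite inordK.
  by rewrite uj -ltnS ltn_ord /p uj; split=> //; apply/eqP/val_inj; rewrite /= inordK.
apply: eq_bigr => j _; rewrite -sum_up_weight !mulr_sumr.
by apply: eq_bigr => u /eqP ->.
Qed.

End Counting.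

End FatFaces.

(** * Arithmetic of the constants *)

Lemma mul_bin_diag2 k j :
  ('C(k.+2, j.+2) * (j.+2 * j.+1) = k.+2 * k.+1 * 'C(k, j))%N.
Proof.
have := mul_bin_diag k.+2 j.+1; have := mul_bin_diag k.+1 j => /= h1 h2.
by rewrite mulnA [(_ * j.+2)%N]mulnC -h2 mulnAC -!mulnA -h1 mulnA [(_ * k.+1)%N]mulnC.
Qed.

Lemma sum_bin k : (\sum_(j < k.+1) 'C(k, j) = 2 ^ k)%N.
Proof.
by rewrite -[2%N]/(1 + 1)%N expnDn; apply: eq_bigr => j _; rewrite !exp1n !muln1.
Qed.

(** The first power of 2 counts the subsets of a bad face; the inner factor comes from
    [weight_bad_small]. The denominator of [eta] is chosen to beat both. *)
Lemma bad_constant (R : realType) (k : nat) (eps N : R) :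
  2 ^+ k.+2 * (2 ^+ k.+1 * (k.+2 * k.+1)%:R
     * (eps / (k.+1%:R ^+ 2 * 2 ^+ (2 * k + 6))) * N) =
  eps * N * (k.+2%:R / (8 * k.+1%:R)).
Proof.
have -> : 2 ^+ (2 * k + 6) = 2 ^+ k * 2 ^+ k * 2 ^+ 6 :> R.
  by rewrite -!exprD addnn -mul2n.
rewrite natrM !exprS expr0.
have p : 2 ^+ k != 0 :> R by rewrite gt_eqF // exprn_gt0.
have q : k.+1%:R != 0 :> R by rewrite pnatr_eq0.
move: (2 ^+ k) p (k.+1%:R) q (k.+2%:R) => a p b q b'.
by field; rewrite p q.
Qed.

Lemma ratio_le (k : nat) (R : realType) : k.+2%:R / (8 * k.+1%:R) <= 4^-1 :> R.
Proof.
rewrite ler_pdivrMr ?mulr_gt0 // -[k.+2%:R]natr1.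
have : 1 <= k.+1%:R :> R by rewrite ler1n.
lra.
Qed.

(** * The thresholds [eta ^ (2 ^ (k - j))] *)

Section SmallFat.
Variables (R : realType) (V : finType) (X : {set {set V}}) (d k : nat).
Hypothesis hX : is_dcomplex d X.
Variables (eta : R) (T : {set {set V}}).
Hypothesis eta0 : 0 < eta.
Hypothesis fatT : fat_family X d k (fun j => eta ^+ (2 ^ (k - j))) T.
Hypothesis kd : (k < d)%N.

Local Notation fw j := (fat_weight R X d T j).

(** The exponents of the top [i] thresholds are 1, 2, 4 and so on, with sum [2 ^ i - 1]. *)
Lemma fat_weight_pow i : (i <= k.+1)%N ->
  eta ^+ (2 ^ i - 1) * fw (k.+1 - i)%N <= fw k.+1.
Proof.
elim: i => [|i IH] ik; first by rewrite subn0 expn0 subnn expr0 mul1r.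
apply: le_trans (IH (ltnW ik)).
have -> : (2 ^ i.+1 - 1 = (2 ^ i - 1) + 2 ^ i)%N.
  by have := expn_gt0 2 i; rewrite expnS; lia.
rewrite exprD -mulrA ler_pM2l ?exprn_gt0 // subSS subSn //.
have := fat_weight_step fatT (leq_subr i k).
by rewrite subKn.
Qed.

(** The empty face has weight 1, so if it were fat, [fat_weight_pow] would contradict smallness. *)
Lemma set0_notin_fat : fw k.+1 < eta ^+ (2 ^ k.+1 - 1) -> set0 \notin T.
Proof.
move=> small; apply/negP => T0.
have := fat_weight_pow (leqnn _); rewrite subnn => le.
have : 1 <= fw 0%N.
  rewrite /fat_weight (bigD1 set0) /=; last by rewrite T0 cards0.
  rewrite weight_set0 // lerDl; apply: sumr_ge0 => z _; exact: weight_ge0.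
move=> le1; have := le_lt_trans le small.
by rewrite gtr_pMr ?exprn_gt0 // ltNge le1.
Qed.

(** The exponent of [h_j] exceeds by one the exponent lost in [fat_weight_pow], so every grade
    contributes a multiple of [eta * fw k.+1]; the binomials then sum to a power of 2. *)
Lemma weight_bad_small (l : R) : l <= Num.min (eta ^+ (2 ^ k)) 1 ->
  (forall u (g : V -> R), u \in X -> (#|u| < d)%N ->
     \sum_v \sum_v' eweight R X d u v v' * g v * g v' <=
     #|u|.+2%:R * (l * (\sum_v vweight R X d u v * g v ^+ 2)
      + (\sum_v vweight R X d u v * g v) ^+ 2 / (#|u|.+1%:R * weight R d X u))) ->
  \sum_(y in faces X k.+2 | `[< ~ good T y >]) weight R d X y <=
  2 ^+ k.+1 * (k.+2 * k.+1)%:R * eta * fw k.+1.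
Proof.
rewrite le_min => /andP[l1 l2] form.
have lh j : (j <= k)%N -> l <= eta ^+ (2 ^ (k - j)).
  (* For [eta >= 1] all thresholds are at least 1; otherwise the smallest is the one at [j = 0]. *)
  move=> jk; have [e1|e1] := leP 1 eta; first by apply: le_trans l2 _; rewrite exprn_ege1.
  by apply: le_trans l1 _; apply: ler_wiXn2l; rewrite ?ltW // leq_exp2l ?leq_subr.
apply: le_trans (weight_bad_le hX fatT kd lh _ form) _.
  by move=> j _; rewrite exprn_ge0 // ltW.
apply: (@le_trans _ _ (\sum_(j < k.+1)
   'C(k, j)%:R * (2 * (k.+2 * k.+1)%:R * eta * fw k.+1))).
  apply: ler_sum => j _; have jk : (j <= k)%N by rewrite -ltnS ltn_ord.
  have le1 : eta ^+ (2 ^ (k - j)) * fw j.+1 <= eta * fw k.+1.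
    have := @fat_weight_pow (k - j) (leq_trans (leq_subr _ _) (leqnSn _)).
    rewrite subSn ?leq_subr // subKn // => le.
    have -> : (2 ^ (k - j) = (2 ^ (k - j) - 1).+1)%N.
      by have := expn_gt0 2 (k - j); lia.
    by rewrite exprS -mulrA ler_pM2l.
  set a := eta ^+ _ in le1 *.
  have -> : 'C(k.+2, j.+2)%:R * (j.+2%:R * (2 * a) * (j.+1%:R * fw j.+1)) =
     ('C(k.+2, j.+2) * (j.+2 * j.+1))%:R * (2 * (a * fw j.+1)).
    by rewrite !natrM; ring.
  rewrite mul_bin_diag2.
  have -> : 'C(k, j)%:R * (2 * (k.+2 * k.+1)%:R * eta * fw k.+1) =
     (k.+2 * k.+1 * 'C(k, j))%:R * (2 * (eta * fw k.+1)).
    by rewrite !natrM; ring.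
  by apply: ler_wpM2l => //; rewrite ler_pM2l.
rewrite -mulr_suml -natr_sum sum_bin natrX exprS.
set a := (k.+2 * _)%:R; set b := fw _; set c := 2 ^+ k.
by rewrite le_eqVlt; apply/orP; left; apply/eqP; ring.
Qed.

End SmallFat.

(** * Assembling the bounds *)

Theorem theorem8p2 (R : realType) (k : nat) (e : 'I_k.+1 -> R) (eps lambda : R)
  (V : finType) (X : {set {set V}}) (F : aug_sheaf X) (d : nat)
  (he : forall i, 0 <= e i)
  (heps : eps = \big[Num.min/(k.+2%:R * e ord0 / k.+1%:R)]_(i < k.+1)
                   (k.+2%:R * e i / (k.+1 - i)%:R))
  (hlambda : lambda = d%:R^-1 *
      Num.min ((eps / (k.+1%:R ^+ 2 * 2 ^+ (2 * k + 6))) ^+ (2 ^ k)) 1)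
  (hd : (k.+1 <= d)%N)
  (hX : is_dcomplex d X)
  (hconn : strongly_connected d X)
  (hF : is_sheaf F)
  (hcb : forall i : 'I_k.+1, local_cobd_expander F d i.+1 k.+1 (e i))
  (hspec : local_spectral_expander d X d.-1 (-1) lambda)
  (hne : forall x, x \in faces X k.+2 -> nontrivial (F x)) :
  expands_small_locally_minimal F d k.+1 (eps / 2)
    ((eps / (k.+1%:R ^+ 2 * 2 ^+ (2 * k + 6))) ^+ (2 ^ k.+1 - 1)).
Proof.
move=> f cf lm small.
have norm0 n (g : cochain F) : 0 <= norm R d n g.
  by apply: sumr_ge0 => x _; exact: weight_ge0.
have eps0 : 0 <= eps.
  have pos i : 0 <= k.+2%:R * e i / (k.+1 - i)%:R by rewrite divr_ge0 // mulr_ge0.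
  rewrite heps; elim/big_ind: _ => [|a b a0 b0|i _]; last exact: pos.
    by rewrite divr_ge0 // mulr_ge0.
  by rewrite le_min a0.
have eps_le (i : 'I_k.+1) : eps <= k.+2%:R * e i / (k.+1 - i)%:R.
  by rewrite heps bigmin_le // orbC lexx.
(* The claim is trivial for [eps = 0], and the thresholds below need [eta > 0]. *)
have [eps_eq0|eps_neq0] := eqVneq eps 0.
  by rewrite eps_eq0 !mul0r.
have {eps0 eps_neq0} eps0 : 0 < eps by rewrite lt_def eps_neq0.
set c := k.+1%:R ^+ 2 * 2 ^+ (2 * k + 6) in small hlambda *.
have c0 : 0 < c by rewrite mulr_gt0 // exprn_gt0.
set eta := eps / c in small hlambda *.
have eta0 : 0 < eta by rewrite divr_gt0.
pose A := [set x in faces X k.+1 | orient f x != 0].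
have AX : A \subset faces X k.+1 by apply/subsetP=> x; rewrite inE => /andP[].
have [T fatT TA] := fat_family_exists d (fun j => eta ^+ (2 ^ (k - j))) AX.
have suppT x : x \in faces X k.+1 -> (x \in T) = (orient f x != 0).
  move=> xX; rewrite TA ?inE; first by move: xX; rewrite inE => /andP[-> ->].
  by move: xX; rewrite inE => /andP[_ /eqP].
set N := norm R d k.+1 f in small *.
have NE : N = \sum_(x in faces X k.+1 | orient f x != 0) weight R d X x.
  rewrite /N /norm; apply: eq_bigl => x; apply: andb_id2l => xX.
  by rewrite (cochain_eq0 cf) // ordered_face_enum.
have fwN : fat_weight R X d T k.+1 = N.
  rewrite NE /fat_weight; apply: eq_bigl => x; apply/andP/andP => [[xT cx]|[xX fx]].
    have xX : x \in faces X k.+1.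
      by rewrite inE cx andbT; case: fatT => /(_ x xT); rewrite inE => /andP[].
    by rewrite -suppT.
  by rewrite suppT //; move: xX; rewrite inE => /andP[].
have T0 : set0 \notin T by apply: (set0_notin_fat hX eta0 fatT); rewrite ?fwN.
have d0 : 0 < d%:R :> R by rewrite ltr0n (leq_ltn_trans (leq0n k)).
have min0 : 0 <= Num.min (eta ^+ (2 ^ k)) 1 by rewrite le_min ler01 exprn_ge0 // ltW.
have dl : d%:R * lambda = Num.min (eta ^+ (2 ^ k)) 1.
  by rewrite hlambda mulrA mulfV ?mul1r // gt_eqF.
have l0 : 0 <= lambda by rewrite -(pmulr_rge0 _ d0) dl.
have l1 : lambda * d%:R <= 1 by rewrite mulrC dl ge_min lexx orbT.
have bad := weight_bad_small hX eta0 fatT hd (l := d%:R * lambda) _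
  (fun u g uX ud => link_form_le hX g l0 l1 hconn hspec uX ud).
rewrite dl lexx fwN in bad; move/(_ isT): bad => bad.
pose D (z : {set V}) := [pred y | connect (descent T) y z].
pose B (z : {set V}) : R := \sum_(y in faces X k.+2 |
   (z \subset y) && (face_cobd (mask (D z) (orient f)) y != 0)) weight R d X y.
have local z : terminal T z ->
    eps * (\sum_(x in faces X k.+1 | D z x && (orient f x != 0)) weight R d X x) <= B z.
  case/andP=> zT _; have := fatT => -[/(_ z zT) + _]; rewrite inE => /andP[zX ck].
  have z0 : (0 < #|z|)%N by rewrite lt0n cards_eq0; apply: contra T0 => /eqP <-.
  have zi : (#|z|.-1 < k.+1)%N by rewrite prednK.
  have zf : z \in faces X #|z| by rewrite inE zX eqxx.
  have ze : #|z|.-1.+1 = #|z| by rewrite prednK.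
  (* [z] has dimension [i]. If [z] lies in the support itself then [n = 0], which is dimension -1 in
     the link. *)
  pose i := Ordinal zi; pose n := (k.+1 - #|z|)%N.
  have nE : (n + #|z| = k.+1)%N by rewrite subnK.
  have nE' : (n.+1 + #|z| = k.+2)%N by rewrite addSn nE.
  have ex : cobd_expander (link_sheaf F z) (d - #|z|) n (e i).
    by have := hcb i z; rewrite /= ze; apply.
  have zd : (0 < #|z| <= d)%N by rewrite z0 (leq_trans ck hd).
  have := @local_expansion R V X F d hX n #|z| z (enum z) f (D z) (e i)
    (ordered_face_enum zf) zd.
  rewrite nE nE' => /(_ hd cf lm (@descent_sub V T ^~ z) hne (he i) ex).
  rewrite -/(B z); set W := \sum_(x in _ | _) _ => le.
  have W0 : 0 <= W by apply: sumr_ge0 => x _; exact: weight_ge0.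
  have b1 : 0 < 'C(k.+1, #|z|)%:R :> R by rewrite ltr0n bin_gt0.
  have b2 : 0 < (k.+1 - i)%:R :> R by rewrite ltr0n subn_gt0.
  (* This ratio of binomials is the factor (k+2)/(k+1-i) in the definition of [eps]. *)
  have bE : (k.+1 - i)%:R * 'C(k.+2, #|z|)%:R = k.+2%:R * 'C(k.+1, #|z|)%:R :> R.
    rewrite -!natrM (mul_bin_down k.+2 #|z|); congr ((_ * _)%:R).
    by rewrite -[in RHS]ze subSS.
  rewrite -(ler_pM2l b1); apply: le_trans le.
  rewrite mulrA; apply: ler_wpM2r => //.
  have := eps_le i; rewrite ler_pdivlMr // => le2.
  rewrite -(ler_pM2r b2).
  have -> : e i * 'C(k.+2, #|z|)%:R * (k.+1 - i)%:R =
      'C(k.+1, #|z|)%:R * (k.+2%:R * e i).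
    by rewrite -mulrA [_ * (_ - _)%:R]mulrC bE; ring.
  by rewrite -mulrA ler_pM2l.
have ub : \sum_(z | terminal T z) B z <=
    norm R d k.+2 (cobd f) + 2 ^+ k.+2 * (2 ^+ k.+1 * (k.+2 * k.+1)%:R * eta * N).
  apply: le_trans (lerD (lexx _) (ler_wpM2l _ bad)); last by rewrite exprn_ge0.
  rewrite /norm [X in _ <= X + _]big_mkcondr [X in _ <= _ + X]mulr_sumr.
  rewrite [X in _ <= _ + X]big_mkcondr -big_split /=.
  under eq_bigr do rewrite /B big_mkcondr.
  rewrite exchange_big /=; apply: ler_sum => y yX.
  have wy := weight_ge0 R X d y.
  have := ler_wpM2r wy (terminal_count R hX suppT yX).
  rewrite (cobd_eq0 hX cf); last exact: ordered_face_enum.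
  rewrite mulr_suml mulrDl => le; apply: le_trans (le_trans le _).
    apply: ler_sum => z _; rewrite -[(_ && _)]/(_ && _).
    by case: ((_ \subset _) && _); rewrite ?mul1r ?mul0r.
  apply: lerD; first by case: (_ != 0); rewrite ?mul1r ?mul0r.
  by case: `[< _ >]; rewrite ?mul1r ?mul0r // mulr0.
(* Each face of the support descends to at least one terminal face; being counted several times only
   helps. *)
have lb : eps * N <= \sum_(z | terminal T z) B z.
  apply: (@le_trans _ _ (\sum_(z | terminal T z)
    eps * (\sum_(x in faces X k.+1 | D z x && (orient f x != 0)) weight R d X x))).
    rewrite -mulr_sumr ler_pM2l // NE.
    under [X in _ <= X]eq_bigr do rewrite big_mkcondr.
    rewrite exchange_big /= big_mkcondr; apply: ler_sum => x xX.
    have wx := weight_ge0 R X d x.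
    have pos (P : pred {set V}) (Q : pred {set V}) :
        0 <= \sum_(z | P z) (if Q z then weight R d X x else 0).
      by apply: sumr_ge0 => z _; case: ifP.
    case: ifP => fx; last exact: (pos _ (fun z => _ && false)).
    have xT : x \in T by rewrite suppT.
    have [z tz xz] := terminal_exists xT.
    rewrite (bigD1 z) //= /D /= xz /= lerDl; apply: sumr_ge0 => z' _.
    by case: ifP.
  exact: ler_sum.
have := le_trans lb ub.
rewrite bad_constant.
have eN : 0 <= eps * N by rewrite mulr_ge0 ?(ltW eps0) ?norm0.
(* The bad faces cost at most a quarter of [eps * N], within the half that may be lost. *)
have := ler_wpM2l eN (ratio_le k R).
rewrite [eps / 2 * N]mulrAC.
move: (eps * N * _) (norm R d k.+2 _) => b g; move: (eps * N) eN => a.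
clear; lra.
Qed.
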